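(* Let $z$ and $y$ be fixed with $0<z<q$ and $Y^{+}(z)<y\le 1$. Then, as $N\to\infty$ through integers for which $n=zN$ is an integer, and with $x=yN$, $$K_n(x)\sim \frac{1}{\sqrt{2\pi N}}\exp\left[N\psi^{+}(y,z)\right]L^{+}(y,z),$$ i.e. the ratio of the two sides tends to $1$.
   Context: Fix real $0<p,q<1$ with $p+q=1$. For integers $n,N\ge 0$ and real $x$, the Krawtchouk polynomial is $$K_n(x)=K_n(x,N,p,q)=\sum_{k=0}^{n}\binom{x}{k}\binom{N-x}{n-k}q^{k}(-p)^{n-k},$$ where $\binom{a}{k}=a(a-1)\cdots(a-k+1)/k!$ for real $a$ and integer $k\geq 0$. For $0<z<1$ put $$U_0(z)=\sqrt{\frac{pq(1-z)}{z}},\qquad Y^{\pm}(z)=p+(q-p)z\pm 2zU_0(z),$$ $$U^{+}(y,z)=-\frac12\left(\frac{p-y}{z}+q-p\right)+\frac12\sqrt{\left(\frac{p-y}{z}+q-p\right)^2-4U_0(z)^2},$$ $$\psi^{+}(y,z)=\ln\left[(U^{+})^{z-1}(U^{+}-p)^{1-y}(U^{+}+q)^{y}\right],$$ $$L^{+}(y,z)=\sqrt{\frac{(U^{+}-p)(U^{+}+q)}{z\left[(U^{+})^2-U_0^2\right]}},$$ with $U^{+}=U^{+}(y,z)$ (in the stated range $U^+>p$, so all quantities are real). *)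

(* Defs.v *)
From mathcomp Require Import all_boot all_order all_algebra.
From mathcomp Require Import all_classical all_reals all_analysis.

Set Implicit Arguments.
Unset Strict Implicit.
Unset Printing Implicit Defensive.

Import Order.TTheory GRing.Theory Num.Theory.
Import numFieldNormedType.Exports.

Local Open Scope ring_scope.

Section Krawtchouk.
Variable R : realType.
Implicit Types (p q x y z a : R) (n N k : nat).

(* a (a - 1) ... (a - k + 1) / k! for real a; the library's 'C(_, _) takes
   natural-number arguments only. *)
Definition gbinom a k : R := (\prod_(i < k) (a - i%:R)) / k`!%:R.

Definition krawtchouk p q N n x : R :=
  \sum_(k < n.+1)
    gbinom x k * gbinom (N%:R - x) (n - k) * q ^+ k * (- p) ^+ (n - k).

Definition U0 p q z : R := Num.sqrt (p * q * (1 - z) / z).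

Definition Yplus p q z : R := p + (q - p) * z + 2 * z * U0 p q z.

Definition Uplus p q y z : R :=
  - (1 / 2) * ((p - y) / z + q - p)
  + 1 / 2 * Num.sqrt (((p - y) / z + q - p) ^+ 2 - 4 * U0 p q z ^+ 2).

(* For 0 < z < q and Yplus p q z < y <= 1 one has p < Uplus p q y z and
   U0 p q z < Uplus p q y z, so that the default values of the total functions
   ln, powR and Num.sqrt outside their usual domains play no role below. *)
Definition psiplus p q y z : R :=
  let U := Uplus p q y z in
  ln (U `^ (z - 1) * (U - p) `^ (1 - y) * (U + q) `^ y).

Definition Lplus p q y z : R :=
  let U := Uplus p q y z in
  Num.sqrt ((U - p) * (U + q) / (z * (U ^+ 2 - U0 p q z ^+ 2))).

Definition krawtchouk_approx p q y z N : R :=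
  (Num.sqrt (2 * pi * N%:R))^-1 * expR (N%:R * psiplus p q y z)
  * Lplus p q y z.

End Krawtchouk.

(* Main.v *)
Require Import Defs.
From mathcomp Require Import all_boot all_order all_algebra.
From mathcomp Require Import all_classical all_reals all_analysis.
From mathcomp Require Import measurable_realfun.
From mathcomp Require Import ring lra.
Set Implicit Arguments.
Unset Strict Implicit.
Unset Printing Implicit Defensive.

Import Order.TTheory GRing.Theory Num.Theory.
Import numFieldNormedType.Exports.
Local Open Scope classical_set_scope.
Local Open Scope ring_scope.

(** Saddle point method, in real variables.

    The generating function [sum_n K_n(x) w^n = (1 + q w)^x (1 - p w)^(N - x)]
    has its saddle point at [w = 1 / U+], and the circle through it may enclose
    the branch point [- 1 / q].  The substitution [v = w / (1 + q w)] removes this difficulty: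
    with [b = N - x] it turns the coefficient into
    [K_n(x) = [v^n] (1 - v)^b (1 - q v)^(- (N - n + 1))] ([krawtchouk_rising]),
    and the saddle point becomes [r = 1 / (U+ + q) < 1], inside the disc where
    both factors have convergent binomial series ([binomial_series]).

    Integrating the two series term by term over the circle [|v| = r], and
    keeping real parts, expresses [pi K_n(x)] as an integral over [[0, pi]]
    ([coefficient_integral]) whose integrand is, up to the factor
    [exp (N psi+)],
    [exp (N growth(th)) amplitude(th) cos (N drift(th) + phase(th))]
    ([krawtchouk_integral]).  With [r] at the saddle point the drift is
    [O(th^3)] and the growth is [- S th^2 / 2 + O(th^4)].  Since also [z < y],
    the growth decreases on the whole of [[0, pi]], at least like a multiple of
    [- th^2] ([log_exponent_le], [onem_cos_ge]).  Laplace's method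
    ([laplace_method]) then reduces the integral to a Gaussian one, and the
    algebra of the saddle point identifies [1 / ((1 - q r) sqrt S)] with [L+]
    ([Lplus_saddle]) and the exponent with [psi+] ([psiplus_saddle]). *)

(** * Krawtchouk polynomials as Taylor coefficients *)

Section RisingCoefficients.
Variable R : realType.
Implicit Types (b s q : R) (n N k : nat).

(** The Pochhammer coefficient [(s)_k / k!], which is the coefficient of [v^k]
    in [(1 - v)^(- s)]. *)
Definition rising s k : R := (\prod_(i < k) (s + i%:R)) / k`!%:R.

Lemma rising0 s : rising s 0 = 1.
Proof. by rewrite /rising big_ord0 fact0 divr1. Qed.

Lemma risingS s k : k.+1%:R * rising s k.+1 = (s + k%:R) * rising s k.
Proof.
rewrite /rising big_ord_recr /= factS natrM invfM.
have k0 : k.+1%:R != 0 :> R by rewrite pnatr_eq0.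
by rewrite [RHS]mulrC; move: (k`!%:R^-1) k0 => f k0; field.
Qed.

Lemma gbinomE b k : (-1) ^+ k * gbinom b k = rising (- b) k.
Proof.
rewrite /gbinom /rising mulrA; congr (_ / _).
rewrite -{1}(card_ord k) -prodr_const -big_split /=.
by apply: eq_bigr => i _; rewrite mulN1r opprB addrC.
Qed.

Lemma gbinomS b k : k.+1%:R * gbinom b k.+1 = (b - k%:R) * gbinom b k.
Proof.
rewrite /gbinom big_ord_recr /= factS natrM invfM.
have k0 : k.+1%:R != 0 :> R by rewrite pnatr_eq0.
by rewrite [RHS]mulrC; move: (k`!%:R^-1) k0 => f k0; field.
Qed.

Lemma gbinom_nat n k : gbinom (n%:R : R) k = 'C(n, k)%:R.
Proof.
elim: k => [|k IH]; first by rewrite /gbinom big_ord0 fact0 divr1 bin0.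
have k0 : k.+1%:R != 0 :> R by rewrite pnatr_eq0.
apply: (mulfI k0); rewrite gbinomS IH -natrM mul_bin_left natrM.
have [kn|nk] := leqP k n; first by rewrite natrB.
by rewrite bin_small// !mulr0.
Qed.

Lemma rising_nat n k : rising (n.+1%:R : R) k = 'C(n + k, k)%:R.
Proof.
elim: k => [|k IH]; first by rewrite rising0 bin0.
have k0 : k.+1%:R != 0 :> R by rewrite pnatr_eq0.
apply: (mulfI k0); rewrite risingS IH -!natrD -!natrM; congr _%:R.
by rewrite addnS -mul_bin_diag addSn.
Qed.

Definition gbinom_poly k : {poly R} :=
  (k`!%:R^-1) *: \prod_(i < k) ('X - (i%:R)%:P).

Lemma horner_gbinom_poly k b : (gbinom_poly k).[b] = gbinom b k.
Proof.
rewrite /gbinom_poly hornerZ horner_prod mulrC; congr (_ / _).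
by apply: eq_bigr => i _; rewrite hornerXsubC.
Qed.

Lemma size_gbinom_poly k : (size (gbinom_poly k) <= k.+1)%N.
Proof.
apply: (leq_trans (size_scale_leq _ _)).
by rewrite size_prod_XsubC /index_enum -enumT size_enum_ord.
Qed.

(** For natural [b <= N] both sides are the coefficient of [X^n] in
    [(1 + q X)^(N - b) (1 - p X)^b], once expanded directly and once after
    writing [1 - p X = (1 + q X) - X]. *)
Lemma vandermonde_nat q n N (b : nat) : (b <= N)%N ->
  \sum_(k < n.+1) 'C(N - b, k)%:R * 'C(b, n - k)%:R * q ^+ k
    * (q - 1) ^+ (n - k) =
  \sum_(j < n.+1) (-1) ^+ j * 'C(b, j)%:R * 'C(N - j, n - j)%:R
    * q ^+ (n - j) :> R.
Proof.
move=> bN.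
have pow (a : R) m : (1 + a *: 'X : {poly R}) ^+ m
    = \poly_(i < m.+1) ('C(m, i)%:R * a ^+ i).
  rewrite exprDn poly_def; apply: eq_bigr => i _.
  by rewrite expr1n mul1r exprZn -scaler_nat scalerA.
have cpow (a : R) m i : ((1 + a *: 'X : {poly R}) ^+ m)`_i = 'C(m, i)%:R * a ^+ i.
  rewrite pow coef_poly; case: ltnP => // mi.
  by rewrite bin_small// mul0r.
transitivity (((1 + q *: 'X : {poly R}) ^+ (N - b)
   * (1 + (q - 1) *: 'X) ^+ b)`_n).
  by rewrite coefM; apply: eq_bigr => k _; rewrite !cpow; ring.
have -> : (1 + (q - 1) *: 'X : {poly R}) = (1 + q *: 'X) + (-1) *: 'X.
  by rewrite scalerBl scaleN1r scale1r addrA.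
rewrite [X in _ * X]exprDn mulr_sumr coef_sum.
pose F j : R := (-1) ^+ j * 'C(b, j)%:R * 'C(N - j, n - j)%:R * q ^+ (n - j).
have term j : (j <= b)%N -> ((1 + q *: 'X : {poly R}) ^+ (N - b) *
   ((1 + q *: 'X) ^+ (b - j) * (-1 *: 'X) ^+ j *+ 'C(b, j)))`_n
   = if (j <= n)%N then F j else 0.
  move=> jb.
  rewrite mulrnAr mulrA -exprD coefMn exprZn -scalerAr coefZ coefMXn.
  rewrite ltnNge; case: leqP => //= jn; last by rewrite mulr0 mul0rn.
  rewrite cpow (_ : (N - b + (b - j) = N - j)%N); last first.
    by rewrite addnBA// subnK.
  by rewrite /F -mulr_natr; ring.
transitivity (\sum_(j < b.+1) (if (j <= n)%N then F j else 0)).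
  by apply: eq_bigr => j _; rewrite term// -ltnS ltn_ord.
rewrite -(big_mkord xpredT F).
rewrite -(big_mkord xpredT (fun j => if (j <= n)%N then F j else 0)).
rewrite -big_mkcond /=.
have F0 j : (b < j)%N -> F j = 0.
  by move=> bj; rewrite /F bin_small// mulr0 !mul0r.
have [bn|nb] := leqP b n.
  rewrite [RHS](@big_cat_nat _ _ _ b.+1)//= [X in _ + X]big_nat_cond.
  rewrite [X in _ + X]big1 ?addr0; last first.
    by move=> i /andP[/andP[bi _] _]; exact: F0.
  rewrite big_nat_cond [RHS]big_nat_cond; apply: eq_bigl => i.
  by rewrite andbT; apply/andb_idr => /andP[_ ib]; apply: leq_trans bn.
rewrite (@big_cat_nat _ _ _ n.+1)//=; last by rewrite ltnW.
rewrite [X in _ + X]big_nat_cond [X in _ + X]big1 ?addr0; last first.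
  by move=> i /andP[/andP[ni _]]; rewrite leqNgt ni.
by rewrite big_nat_cond [RHS]big_nat_cond; apply: eq_bigl => i;
  rewrite ltnS; case: (i <= n)%N.
Qed.

(** Both sides are polynomials in [b] of degree at most [n] that agree at the
    [N + 1 > n] points [0, ..., N].  The right-hand side is the coefficient of
    [v^n] in [(1 - v)^b (1 - q v)^(- (N - n + 1))], which comes from the
    generating function [(1 + q w)^(N - b) (1 - p w)^b] by [v = w / (1 + q w)];
    the gain is that the saddle point always lies inside the unit disc. *)
Lemma krawtchouk_rising q n N b : (n <= N)%N ->
  krawtchouk (1 - q) q N n (N%:R - b) =
  \sum_(j < n.+1) rising (- b) j
    * (rising ((N - n).+1%:R) (n - j) * q ^+ (n - j)).
Proof.
move=> nN.
pose P : {poly R} := \sum_(k < n.+1) (q ^+ k * (q - 1) ^+ (n - k)) *: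
   ((gbinom_poly k \Po ((N%:R)%:P - 'X)) * gbinom_poly (n - k)).
pose Q : {poly R} := \sum_(j < n.+1)
   ((-1) ^+ j * 'C(N - j, n - j)%:R * q ^+ (n - j)) *: gbinom_poly j.
have PE c : P.[c] = krawtchouk (1 - q) q N n (N%:R - c).
  rewrite horner_sum; apply: eq_bigr => k _.
  rewrite hornerZ hornerM horner_comp !horner_gbinom_poly hornerD hornerN hornerC.
  by rewrite hornerX subKr opprB; ring.
have QE c : Q.[c] = \sum_(j < n.+1) rising (- c) j
    * (rising ((N - n).+1%:R) (n - j) * q ^+ (n - j)).
  rewrite horner_sum; apply: eq_bigr => -[j /= jn] _.
  rewrite hornerZ horner_gbinom_poly -gbinomE rising_nat.
  rewrite addnBA// subnK//; first by ring.
have sP : (size P <= n.+1)%N.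
  apply: (leq_trans (size_sum _ _ _)); apply/bigmax_leqP => -[k /= kn] _.
  apply: (leq_trans (size_scale_leq _ _)).
  apply: (leq_trans (size_polyMleq _ _)).
  have s1 : (size (gbinom_poly k \Po ((N%:R)%:P - 'X)) <= k.+1)%N.
    have [->|g0] := eqVneq (gbinom_poly k) 0; first by rewrite comp_poly0 size_poly0.
    have sX : size ((N%:R)%:P - 'X : {poly R}) = 2.
      by rewrite -opprB size_polyN size_XsubC.
    rewrite -(@prednK (size (_ \Po _))) ?ltnS; last first.
      rewrite size_poly_gt0; apply: contra g0.
      by rewrite comp_poly2_eq0.
    rewrite size_comp_poly sX muln1.
    by have := size_gbinom_poly k; case: (size _).
  have := leq_add s1 (size_gbinom_poly (n - k)).
  rewrite addSn addnS subnKC//.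
  by case: (_ + _)%N.
have sQ : (size Q <= n.+1)%N.
  apply: (leq_trans (size_sum _ _ _)); apply/bigmax_leqP => -[j /= jn] _.
  apply: (leq_trans (size_scale_leq _ _)).
  exact: (leq_trans (size_gbinom_poly _)).
suff PQ : P = Q by rewrite -PE PQ QE.
apply/eqP; rewrite -subr_eq0; apply/negPn/negP => D0.
have := @max_poly_roots _ (P - Q) [seq (i%:R : R) | i <- iota 0 N.+1] D0.
rewrite size_map size_iota map_inj_uniq ?iota_uniq; last first.
  by move=> i j /eqP; rewrite eqr_nat => /eqP.
move=> H; have : (N.+1 < size (P - Q)%R)%N.
  apply: H => //; apply/allP => _ /mapP[c + ->].
  rewrite mem_iota /= add0n ltnS => cN.
  rewrite /root hornerD hornerN subr_eq0 PE /Q horner_sum; apply/eqP.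
  transitivity (\sum_(k < n.+1) 'C(N - c, k)%:R * 'C(c, n - k)%:R * q ^+ k
    * (q - 1) ^+ (n - k) : R).
    by apply: eq_bigr => k _; rewrite subKr -natrB// !gbinom_nat opprB.
  rewrite vandermonde_nat//; apply: eq_bigr => j _.
  by rewrite hornerZ horner_gbinom_poly gbinom_nat; ring.
rewrite ltnNge => /negP; apply.
apply: (leq_trans (size_polyD _ _)); rewrite size_polyN geq_max.
by rewrite !(leq_trans _ (nN : n.+1 <= N.+1)%N).
Qed.

End RisingCoefficients.

(** * The defect of a partial sum of the binomial series *)

Section BinomialSeries.
Variable R : realType.
Implicit Types (s t th : R) (n m k : nat).

(** The derivative of [(1 - v)^(- s)] is [s (1 - v)^(- s - 1)]. *)
Lemma rising_shift s k : k.+1%:R * rising s k.+1 = s * rising (s + 1) k.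
Proof.
elim: k => [|k IH]; first by rewrite risingS !rising0 addr0.
have k0 : k.+1%:R != 0 :> R by rewrite pnatr_eq0.
rewrite risingS; apply: (mulfI k0); rewrite mulrCA IH.
by rewrite [RHS]mulrCA risingS -nat1r; ring.
Qed.

Lemma rising_pascal s k :
  rising (s + 1) k.+1 = rising (s + 1) k + rising s k.+1.
Proof.
have k0 : k.+1%:R != 0 :> R by rewrite pnatr_eq0.
apply: (mulfI k0); rewrite mulrDr risingS rising_shift -nat1r; ring.
Qed.

Lemma rising_ge0 s k : 0 <= s -> 0 <= rising s k.
Proof.
by move=> s0; rewrite divr_ge0// prodr_ge0// => i _; rewrite addr_ge0.
Qed.

Lemma norm_rising_le s m k : `|s| <= m%:R -> `|rising s k| <= rising m%:R k.
Proof.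
move=> sm; rewrite normrM normfV [`|k`!%:R|]ger0_norm//.
rewrite ler_wpM2r ?invr_ge0// normr_prod ler_prod// => i _.
by rewrite normr_ge0 (le_trans (ler_normD _ _))// [`|i%:R|]ger0_norm// lerD2r.
Qed.

(** Induction on [m]: by Pascal's rule, multiplying by [1 - t] turns the sum for
    [m + 1] into at most the sum for [m]. *)
Lemma sum_rising_nat_le m t n : 0 <= t < 1 ->
  \sum_(k < n) rising m%:R k * t ^+ k <= (1 - t)^-1 ^+ m.
Proof.
move=> /andP[t0 t1]; elim: m n => [|m IH] n.
  case: n => [|n]; first by rewrite big_ord0.
  rewrite big_ord_recl rising0 big1 ?addr0 ?mulr1// => i _.
  by rewrite /rising /bump/= big_ord_recl addr0 !mul0r.
have u0 : 0 < 1 - t by rewrite subr_gt0.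
rewrite exprS -(@ler_pM2l _ (1 - t))// mulrA divff ?gt_eqF// mul1r.
apply: le_trans (IH n); rewrite mulrBl mul1r lerBlDr.
case: n => [|n]; first by rewrite !big_ord0 mulr0 addr0.
rewrite [X in X <= _]big_ord_recl [X in _ <= X + _]big_ord_recl !rising0 -addrA lerD2l.
rewrite big_ord_recr/= mulrDr.
have -> : \sum_(i < n) rising (m.+1%:R : R) (bump 0 i) * t ^+ (bump 0 i) =
  \sum_(i < n) rising (m%:R : R) (bump 0 i) * t ^+ (bump 0 i) +
   t * \sum_(i < n) rising (m.+1%:R : R) i * t ^+ i.
  rewrite mulr_sumr -big_split/=; apply: eq_bigr => i _.
  rewrite /bump/= !add1n -[in LHS]natr1 rising_pascal natr1 exprS; ring.
rewrite lerD2l lerDl mulr_ge0// mulr_ge0 ?exprn_ge0//.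
exact: rising_ge0.
Qed.

(** The exponent is an integer at least [|s|], so that [sum_rising_nat_le]
    bounds the absolute values of the terms. *)
Definition rising_bound s t : R := (1 - t)^-1 ^+ (Num.truncn `|s|).+1.

Lemma sum_norm_rising_le s t n : 0 <= t < 1 ->
  \sum_(k < n) `|rising s k| * t ^+ k <= rising_bound s t.
Proof.
move=> t01; apply: le_trans (sum_rising_nat_le _ n t01).
apply: ler_sum => k _; apply: ler_wpM2r.
  by case/andP: t01 => t0 _; rewrite exprn_ge0.
by apply: norm_rising_le; apply/ltW/truncnS_gt.
Qed.

Lemma rising_cvg0 s t : 0 <= t < 1 -> rising s k * t ^+ k @[k --> \oo] --> 0.
Proof.
move=> t01; have t0 : 0 <= t by case/andP: t01.
apply/norm_cvg0P; apply: cvg_series_cvg_0.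
apply: nondecreasing_is_cvgn.
  apply/nondecreasing_seqP => n; rewrite /series/= big_nat_recr//= lerDl.
  exact: normr_ge0.
exists (rising_bound s t) => _ [n _ <-].
rewrite /series/= big_mkord; apply: le_trans (sum_norm_rising_le s n t01).
by apply: ler_sum => k _; rewrite normrM [`|t ^+ k|]ger0_norm// exprn_ge0.
Qed.

Lemma rising_deriv_cvg0 s t : 0 <= t < 1 ->
  n%:R * rising s n * t ^+ n.-1 @[n --> \oo] --> 0.
Proof.
move=> t01; rewrite -cvg_shiftS/=.
have -> : (fun n => n.+1%:R * rising s n.+1 * t ^+ n)
   = (fun n => s * (rising (s + 1) n * t ^+ n)).
  by apply/funext => n; rewrite rising_shift mulrA.
have := cvgM (cvg_cst s) (rising_cvg0 (s + 1) t01); rewrite mulr0; exact.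
Qed.

(** For [v = t e^(i th)], [normsq t th] is [|1 - v|^2] and [phase t th] is the
    argument of [1 / (1 - v)], so that [powcos s] and [powsin s] are the real
    and imaginary parts of [(1 - v)^(-s)] for the principal branch. *)
Definition normsq t th : R := 1 - 2 * t * cos th + t ^+ 2.
Definition phase t th : R := atan (t * sin th / (1 - t * cos th)).
Definition powcos s t th : R :=
  expR (- (s / 2) * ln (normsq t th)) * cos (s * phase t th).
Definition powsin s t th : R :=
  expR (- (s / 2) * ln (normsq t th)) * sin (s * phase t th).

Lemma normsqE t th : normsq t th = (1 - t * cos th) ^+ 2 + (t * sin th) ^+ 2.
Proof. rewrite /normsq exprMn [in RHS]sin2cos2; ring. Qed.

Lemma tcos_lt1 t th : 0 <= t < 1 -> 0 < 1 - t * cos th.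
Proof.
case/andP => t0 t1; rewrite subr_gt0 (le_lt_trans _ t1)//.
by rewrite ler_piMr// cos_le1.
Qed.

Lemma normsq_ge t th : 0 <= t -> (1 - t) ^+ 2 <= normsq t th.
Proof.
move=> t0; rewrite /normsq -subr_ge0.
have -> : 1 - 2 * t * cos th + t ^+ 2 - (1 - t) ^+ 2 = 2 * t * (1 - cos th).
  by ring.
by rewrite mulr_ge0 ?mulr_ge0// subr_ge0 cos_le1.
Qed.

Lemma normsq_gt0 t th : 0 <= t < 1 -> 0 < normsq t th.
Proof.
case/andP => t0 t1; apply: lt_le_trans (normsq_ge th t0).
by rewrite exprn_gt0// subr_gt0.
Qed.

Lemma normsq_le t th : 0 <= t < 1 -> normsq t th <= 4.
Proof.
case/andP => t0 t1; rewrite /normsq.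
have /andP[c1 c2] : -1 <= cos th <= 1 by rewrite cos_geN1 cos_le1.
nra.
Qed.

Lemma is_derive_normsq t th :
  is_derive t 1 (normsq ^~ th) (2 * (t - cos th)).
Proof.
rewrite /normsq.
by apply: is_derive_eq; rewrite /GRing.scale/=; ring.
Qed.

Lemma is_derive_phase t th : 0 <= t < 1 ->
  is_derive t 1 (phase ^~ th) (sin th / normsq t th).
Proof.
move=> t01; have u0 := tcos_lt1 th t01; have d0 := normsq_gt0 th t01.
have un0 : 1 - t * cos th != 0 by rewrite gt_eqF.
have dn0 : normsq t th != 0 by rewrite gt_eqF.
have dV : is_derive t 1 (fun t => (1 - t * cos th)^-1)
    (cos th / (1 - t * cos th) ^+ 2).
  apply: is_derive_eq; rewrite /GRing.scale/= ?mulr1 ?mul1r.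
  by field.
have dq : is_derive t 1 (fun t => t * sin th / (1 - t * cos th))
    (sin th / (1 - t * cos th) ^+ 2).
  apply: is_derive_eq; rewrite /GRing.scale/= ?mulr1 ?mul1r.
  by field.
have da := is_derive1_comp (is_derive1_atan _) dq; apply: (is_derive_eq da).
rewrite normsqE in dn0 *.
have h : 1 + (t * sin th / (1 - t * cos th)) ^+ 2 =
   ((1 - t * cos th) ^+ 2 + (t * sin th) ^+ 2) / (1 - t * cos th) ^+ 2 by field.
by rewrite h /GRing.scale/=; field; rewrite un0 dn0.
Qed.

Definition binfactor s t th (a b : R) : R :=
  expR (s / 2 * ln (normsq t th)) *
    (a * cos (s * phase t th) + b * sin (s * phase t th)).

(** If [W = A + i B] solves [(1 - v) W' - s e^(i th) W = X + i Y] as a function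
    of [t], where [v = t e^(i th)], then the derivative of [(1 - v)^s W] only
    involves the defect [X + i Y]; [binfactor] is the real part of
    [(1 - v)^s W]. *)
Lemma is_derive_binfactor s t th (A B : R -> R) (a b X Y : R) : 0 <= t < 1 ->
  is_derive t 1 A a -> is_derive t 1 B b ->
  (1 - t * cos th) * a + t * sin th * b - s * (cos th * A t - sin th * B t) = X ->
  (1 - t * cos th) * b - t * sin th * a - s * (cos th * B t + sin th * A t) = Y ->
  is_derive t 1 (fun u => binfactor s u th (A u) (B u))
    (expR (s / 2 * ln (normsq t th)) / normsq t th *
      (cos (s * phase t th) * ((1 - t * cos th) * X - t * sin th * Y) +
       sin (s * phase t th) * (t * sin th * X + (1 - t * cos th) * Y))).
Proof.
move=> t01 dA dB hX hY; have d0 := normsq_gt0 th t01.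
have dn0 : normsq t th != 0 by rewrite gt_eqF.
have dp := is_derive_phase th t01.
have dn := is_derive_normsq t th.
have dl : is_derive t 1 (fun u => ln (normsq u th))
    ((normsq t th)^-1 * (2 * (t - cos th))).
  exact: (@is_derive1_comp _ (@ln R) (normsq ^~ th) _ _ _ (is_derive1_ln d0) dn).
have dlm : is_derive t 1 (fun u => s / 2 * ln (normsq u th))
    (s / 2 * ((normsq t th)^-1 * (2 * (t - cos th)))).
  by apply: is_derive_eq; rewrite /GRing.scale/=; ring.
have dE := @is_derive1_comp _ (@expR R) (fun u => s / 2 * ln (normsq u th))
  _ _ _ (is_derive_expR _) dlm.
have dsp : is_derive t 1 (fun u => s * phase u th) (s * (sin th / normsq t th)).
  by apply: is_derive_eq; rewrite /GRing.scale/=; ring.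
have dC := @is_derive1_comp _ (@cos R) (fun u => s * phase u th)
  _ _ _ (is_derive_cos _) dsp.
have dS := @is_derive1_comp _ (@sin R) (fun u => s * phase u th)
  _ _ _ (is_derive_sin _) dsp.
have := is_deriveM dE (is_deriveD (is_deriveM dA dC) (is_deriveM dB dS)).
rewrite /binfactor => dd; apply: (is_derive_eq dd).
rewrite /GRing.scale/= !fctE/=.
move: (expR _) (cos (s * _)) (sin (s * _)) => E C S.
have h : normsq t th = (1 - t * cos th) ^+ 2 + (t * sin th) ^+ 2 by exact: normsqE.
apply: (mulfI dn0).
transitivity (E * (C * (s * (t - cos th) * A t + s * sin th * B t + normsq t th * a)
   + S * (s * (t - cos th) * B t - s * sin th * A t + normsq t th * b))).
  by field.
transitivity (E * (C * ((1 - t * cos th) * X - t * sin th * Y) +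
   S * (t * sin th * X + (1 - t * cos th) * Y))); last first.
  by field.
congr (E * (C * _ + S * _)).
  transitivity ((1 - t * cos th) * X - t * sin th * Y
    + s * t * A t * (1 - (cos th ^+ 2 + sin th ^+ 2))).
    by rewrite h -hX -hY; ring.
  by rewrite cos2Dsin2 subrr mulr0 addr0.
transitivity (t * sin th * X + (1 - t * cos th) * Y
  + s * t * B t * (1 - (cos th ^+ 2 + sin th ^+ 2))).
  by rewrite h -hX -hY; ring.
by rewrite cos2Dsin2 subrr mulr0 addr0.
Qed.

End BinomialSeries.

(** * The binomial series with real exponent in the unit disc *)

Section BinomialTheorem.
Variable R : realType.
Implicit Types (s t th : R) (n m k : nat).

(** Bounds the weight [|1 - v|^(s - 2)] for [|v| <= t]: the exponential bounds
    [|1 - v|^s], since [(1 - t)^2 <= |1 - v|^2 <= 4], and the factor 6 bounds the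
    trigonometric combination in [is_derive_binfactor]. *)
Definition bound_factor s t : R :=
  6 * expR (`|s| / 2 * (ln 4 - ln ((1 - t) ^+ 2))) / (1 - t) ^+ 2.

Lemma binfactor0 s th (a b : R) : binfactor s 0 th a b = a.
Proof.
rewrite /binfactor /normsq /phase !(mulr0, mul0r, subr0, expr0n, addr0)/=.
by rewrite ln1 atan0 !mulr0 expR0 cos0 sin0 mulr0 addr0 mulr1 mul1r.
Qed.

Lemma bound_factor_ge s t u th (x y T C S : R) : 0 <= u <= t -> t < 1 ->
  `|x| <= T -> `|y| <= T -> `|C| <= 1 -> `|S| <= 1 ->
  `|expR (s / 2 * ln (normsq u th)) / normsq u th *
      (C * ((1 - u * cos th) * x - u * sin th * y) +
       S * (u * sin th * x + (1 - u * cos th) * y))| <= bound_factor s t * T.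
Proof.
move=> /andP[u0 ut] t1 xT yT C1 S1.
have t0 := le_trans u0 ut.
have T0 : 0 <= T := le_trans (normr_ge0 _) xT.
have u1 : 0 <= u < 1 by rewrite u0 (le_lt_trans ut).
have t2 : 0 < (1 - t) ^+ 2 by rewrite exprn_gt0// subr_gt0.
have d1 := normsq_gt0 th u1.
have d2 : (1 - t) ^+ 2 <= normsq u th.
  apply: le_trans (normsq_ge th u0).
  by rewrite lerXn2r ?nnegrE ?subr_ge0 ?lerD2l ?lerN2// ltW// (le_lt_trans ut).
have d3 := normsq_le th u1.
have l1 : `|ln (normsq u th)| <= ln 4 - ln ((1 - t) ^+ 2).
  have a1 : ln (normsq u th) <= ln 4 by rewrite ler_ln ?posrE.
  have a2 : ln ((1 - t) ^+ 2) <= ln (normsq u th) by rewrite ler_ln ?posrE.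
  have a3 : 0 <= ln (4 : R) by rewrite ln_ge0// ler1n.
  have a4 : ln ((1 - t) ^+ 2) <= 0 by rewrite ln_le0//; nra.
  by rewrite ler_norml; apply/andP; split; lra.
rewrite normrM /bound_factor.
have -> : 6 * expR (`|s| / 2 * (ln 4 - ln ((1 - t) ^+ 2))) / (1 - t) ^+ 2 * T =
  expR (`|s| / 2 * (ln 4 - ln ((1 - t) ^+ 2))) / (1 - t) ^+ 2 * (6 * T) by ring.
apply: ler_pM => //.
  rewrite normrM normfV (ger0_norm (expR_ge0 _)) (gtr0_norm d1).
  apply: ler_pM; rewrite ?expR_ge0 ?invr_ge0 ?(ltW d1)//.
    rewrite ler_expR; apply: le_trans (ler_norm _) _.
    by rewrite !normrM normfV (ger0_norm (ler0n _ 2)) ler_wpM2l.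
  by rewrite lef_pV2 ?posrE.
have c1 := cos_max th; have s1 := sin_max th.
have uu : `|u| <= 1 by rewrite ger0_norm// ltW// (le_lt_trans ut).
have m1 (e f g : R) : `|e| <= 1 -> `|f| <= g -> `|e * f| <= g.
  by move=> e1 fg; rewrite normrM -(mul1r g); exact: ler_pM.
have b1 z : `|z| <= T -> `|(1 - u * cos th) * z| <= 2 * T.
  move=> zT; rewrite normrM; apply: ler_pM => //.
  apply: le_trans (ler_normB _ _) _.
  by rewrite normr1 (_ : 2 = 1 + 1)// lerD2l; exact: m1.
have b2 z : `|z| <= T -> `|u * sin th * z| <= T.
  by move=> zT; apply: (m1) => //; exact: m1.
rewrite (_ : 6 * T = 3 * T + 3 * T); last by ring.
apply: le_trans (ler_normD _ _) _; apply: lerD; apply: (m1) => //.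
  apply: le_trans (ler_normB _ _) _.
  by rewrite (_ : 3 * T = 2 * T + T); [rewrite lerD ?b1 ?b2|ring].
apply: le_trans (ler_normD _ _) _.
by rewrite (_ : 3 * T = T + 2 * T); [rewrite lerD ?b1 ?b2|ring].
Qed.

(** The mean value theorem along the ray from [0] to [t e^(i th)]. *)
Lemma binfactor_near_initial s t th (A B a b X Y : R -> R) (T : R) :
  0 <= t < 1 ->
  (forall u : R, is_derive u 1 A (a u)) -> (forall u : R, is_derive u 1 B (b u)) ->
  (forall u, (1 - u * cos th) * a u + u * sin th * b u
     - s * (cos th * A u - sin th * B u) = X u) ->
  (forall u, (1 - u * cos th) * b u - u * sin th * a u
     - s * (cos th * B u + sin th * A u) = Y u) ->
  (forall u, 0 <= u <= t -> `|X u| <= T) ->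
  (forall u, 0 <= u <= t -> `|Y u| <= T) ->
  `|binfactor s t th (A t) (B t) - A 0| <= bound_factor s t * T.
Proof.
move=> /andP[t0 t1] dA dB hX hY XT YT.
pose E u := binfactor s u th (A u) (B u).
pose dE u := expR (s / 2 * ln (normsq u th)) / normsq u th *
      (cos (s * phase u th) * ((1 - u * cos th) * X u - u * sin th * Y u) +
       sin (s * phase u th) * (u * sin th * X u + (1 - u * cos th) * Y u)).
have EdE (u : R) : 0 <= u <= t -> is_derive u 1 E (dE u).
  move=> /andP[u0 ut]; apply: is_derive_binfactor => //.
  by rewrite u0 (le_lt_trans ut).
have EdE' (u : R) : u \in `]0, t[ -> is_derive u 1 E (dE u).
  by rewrite in_itv/= => /andP[u0 ut]; apply: EdE; rewrite !ltW.
have cE : {within `[0, t], continuous E}.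
  apply: derivable_within_continuous => u; rewrite in_itv/= => ut.
  exact/(@ex_derive _ _ _ _ _ _ _ (EdE u ut)).
have [c cI Ec] := MVT_segment t0 EdE' cE.
rewrite -[A 0](binfactor0 s th (A 0) (B 0)) -/(E t) -/(E 0) Ec subr0 normrM.
move: cI; rewrite in_itv/= => cI.
have T0 : 0 <= T by apply: le_trans (XT _ cI).
rewrite -[leRHS]mulr1; apply: ler_pM => //.
  apply: bound_factor_ge => //; [exact: XT|exact: YT|exact: cos_max|exact: sin_max].
by rewrite ger0_norm// ltW.
Qed.

Definition partcos s th n t : R :=
  \sum_(k < n) rising s k * t ^+ k * cos (k%:R * th).
Definition partsin s th n t : R :=
  \sum_(k < n) rising s k * t ^+ k * sin (k%:R * th).


Lemma is_derive_powersum (c : nat -> R) n t :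
  is_derive t 1 (fun u => \sum_(k < n) c k * u ^+ k)
    (\sum_(k < n) c k * (k%:R * t ^+ k.-1)).
Proof.
elim: n => [|n IH].
  under eq_fun do rewrite big_ord0; rewrite big_ord0.
  exact: is_derive_cst.
under eq_fun do rewrite big_ord_recr/=; rewrite big_ord_recr/=.
have dn : is_derive t 1 (fun u : R => c n * u ^+ n) (c n * (n%:R * t ^+ n.-1)).
  have dX := is_deriveZ (c n) (is_deriveX n (is_derive_id t (1 : R))).
  rewrite [X in is_derive _ _ X](_ : _ = c n \*: (id ^+ n)); last first.
    by apply/funext => u; rewrite /= !fctE.
  by apply: (is_derive_eq dX); rewrite /GRing.scale/= mulr1.
exact: is_deriveD.
Qed.

Lemma is_derive_partcos s th n t : is_derive t 1 (partcos s th n)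
  (\sum_(k < n) rising s k * cos (k%:R * th) * (k%:R * t ^+ k.-1)).
Proof.
have -> : partcos s th n =
    fun u => \sum_(k < n) rising s k * cos (k%:R * th) * u ^+ k.
  by apply/funext => u; apply: eq_bigr => k _; rewrite mulrAC.
exact: (is_derive_powersum (fun k => rising s k * cos (k%:R * th))).
Qed.

Lemma is_derive_partsin s th n t : is_derive t 1 (partsin s th n)
  (\sum_(k < n) rising s k * sin (k%:R * th) * (k%:R * t ^+ k.-1)).
Proof.
have -> : partsin s th n =
    fun u => \sum_(k < n) rising s k * sin (k%:R * th) * u ^+ k.
  by apply/funext => u; apply: eq_bigr => k _; rewrite mulrAC.
exact: (is_derive_powersum (fun k => rising s k * sin (k%:R * th))).
Qed.

Definition defect s n t : R := n%:R * rising s n * t ^+ n.-1.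

Lemma natr_expr_pred n t : n%:R * t ^+ n.-1 * t = n%:R * t ^+ n.
Proof. by case: n => [|n]; rewrite ?mul0r// -mulrA -exprSr. Qed.

(** Telescoping: since [(k + 1) a_(k+1) = (s + k) a_k], applying
    [(1 - v) d/dv - s] to a partial sum of the binomial series leaves only the
    boundary term [- n a_n v^(n-1)]. *)
Lemma partial_ode s th n t :
  ((1 - t * cos th) * (\sum_(k < n) rising s k * cos (k%:R * th) * (k%:R * t ^+ k.-1))
   + t * sin th * (\sum_(k < n) rising s k * sin (k%:R * th) * (k%:R * t ^+ k.-1))
   - s * (cos th * partcos s th n t - sin th * partsin s th n t)
   = - (defect s n t * cos (n%:R * th))) /\
  ((1 - t * cos th) * (\sum_(k < n) rising s k * sin (k%:R * th) * (k%:R * t ^+ k.-1))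
   - t * sin th * (\sum_(k < n) rising s k * cos (k%:R * th) * (k%:R * t ^+ k.-1))
   - s * (cos th * partsin s th n t + sin th * partcos s th n t)
   = - (defect s n t * sin (n%:R * th))).
Proof.
rewrite /partcos /partsin /defect; elim: n => [|n [IHc IHs]].
  by rewrite !big_ord0; split; ring.
have th1 : n.+1%:R * th = n%:R * th + th by rewrite -natr1 mulrDl mul1r.
rewrite !big_ord_recr/= risingS th1 cosD sinD.
have e := natr_expr_pred n t.
move: (\sum_(_ < n) _) (\sum_(_ < n) _) IHc IHs.
move: (\sum_(_ < n) _) (\sum_(_ < n) _) => P1 P2 P3 P4 IHc IHs.
move: (cos (n%:R * th)) (sin (n%:R * th)) (rising s n) IHc IHs => C S a IHc IHs.
split.
- apply: (addIr (- (- (n%:R * a * t ^+ n.-1 * C)))); rewrite -[in LHS]IHc.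
  transitivity (a * (n%:R * t ^+ n.-1) * C
    - (a * C * cos th - a * S * sin th) * (n%:R * t ^+ n.-1 * t)
    - s * a * t ^+ n * (cos th * C - sin th * S)); first by ring.
  by rewrite e; ring.
- apply: (addIr (- (- (n%:R * a * t ^+ n.-1 * S)))); rewrite -[in LHS]IHs.
  transitivity (a * (n%:R * t ^+ n.-1) * S
    - (a * S * cos th + a * C * sin th) * (n%:R * t ^+ n.-1 * t)
    - s * a * t ^+ n * (cos th * S + sin th * C)); first by ring.
  by rewrite e; ring.
Qed.

Lemma defect_le s n t u : 0 <= u <= t -> `|defect s n u| <= `|defect s n t|.
Proof.
move=> /andP[u0 ut]; rewrite !normrM ler_wpM2l ?mulr_ge0//.
by rewrite !normrX lerXn2r ?nnegrE// !ger0_norm// (le_trans u0).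
Qed.

(** The second limit concerns the imaginary part of [(1 - v)^s W], which is the
    real part of [(1 - v)^s (- i W)]. *)
Lemma binfactor_part_cvg s t th : 0 <= t < 1 ->
  binfactor s t th (partcos s th n t) (partsin s th n t) @[n --> \oo] --> (1 : R) /\
  binfactor s t th (partsin s th n t) (- partcos s th n t) @[n --> \oo] --> (0 : R).
Proof.
move=> t01.
have part0 n : partcos s th n.+1 0 = 1 /\ partsin s th n.+1 0 = 0.
  rewrite /partcos /partsin !big_ord_recl !big1 => [|i _|i _].
  - by rewrite rising0 mul0r cos0 sin0 !addr0 mulr0 !mulr1.
  - by rewrite expr0n/= mulr0 mul0r.
  - by rewrite expr0n/= mulr0 mul0r.
have small : bound_factor s t * `|defect s n.+1 t| @[n --> \oo] --> (0 : R).
  rewrite -(mulr0 (bound_factor s t)); apply: cvgMl_tmp.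
  have : defect s n t @[n --> \oo] --> 0 by exact: rising_deriv_cvg0.
  by move=> /cvg_norm; rewrite normr0 -cvg_shiftS.
have squeeze (f : nat -> R) (l : R) :
    (forall n, `|f n.+1 - l| <= bound_factor s t * `|defect s n.+1 t|) ->
    f @ \oo --> l.
  move=> fl; rewrite -cvg_shiftS; apply/cvgrPdistC_lt => e e0.
  move/cvgr0Pnorm_lt : small => /(_ _ e0); apply: filterS => n.
  apply: le_lt_trans; apply: le_trans (fl n) _; exact: ler_norm.
have nX n u (C : R) : 0 <= u <= t -> `|C| <= 1 ->
    `|- (defect s n u * C)| <= `|defect s n t|.
  move=> ut C1; rewrite normrN normrM -[leRHS]mulr1.
  by rewrite ler_pM// defect_le.
split; apply: squeeze => n; have [c0 s0] := part0 n.
- rewrite -[X in _ - X]c0.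
  apply: (binfactor_near_initial (A := partcos s th n.+1) (B := partsin s th n.+1)
    (X := fun u => - (defect s n.+1 u * cos (n.+1%:R * th)))
    (Y := fun u => - (defect s n.+1 u * sin (n.+1%:R * th))) t01
    (is_derive_partcos s th n.+1) (is_derive_partsin s th n.+1)).
  + by move=> u; have [] := partial_ode s th n.+1 u.
  + by move=> u; have [] := partial_ode s th n.+1 u.
  + by move=> u ut; apply: nX => //; exact: cos_max.
  + by move=> u ut; apply: nX => //; exact: sin_max.
- rewrite -[X in _ - X]s0.
  apply: (binfactor_near_initial (A := partsin s th n.+1)
    (B := fun u => - partcos s th n.+1 u)
    (X := fun u => - (defect s n.+1 u * sin (n.+1%:R * th)))
    (Y := fun u => - - (defect s n.+1 u * cos (n.+1%:R * th))) t01
    (is_derive_partsin s th n.+1)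
    (fun u => is_deriveN (is_derive_partcos s th n.+1 u))).
  + by move=> u; have [_ <-] := partial_ode s th n.+1 u; ring.
  + by move=> u; have [<- _] := partial_ode s th n.+1 u; ring.
  + by move=> u ut; apply: nX => //; exact: sin_max.
  + by move=> u ut; rewrite normrN; apply: nX => //; exact: cos_max.
Qed.

(** The binomial series [sum_k (s)_k / k! v^k = (1 - v)^(-s)] for a complex [v]
    in the open unit disc and a real exponent: multiplied by [(1 - v)^s], its
    partial sums tend to [1]. *)
Lemma binomial_series s t th : 0 <= t < 1 ->
  partcos s th n t @[n --> \oo] --> powcos s t th /\
  partsin s th n t @[n --> \oo] --> powsin s t th.
Proof.
move=> t01; have [h1 h2] := binfactor_part_cvg s th t01.
set C := cos (s * phase t th); set S := sin (s * phase t th).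
set M := expR (- (s / 2) * ln (normsq t th)).
have MV : M * expR (s / 2 * ln (normsq t th)) = 1.
  by rewrite -expRD mulNr addNr expR0.
have cs : C ^+ 2 + S ^+ 2 = 1 by exact: cos2Dsin2.
split.
- rewrite (_ : powcos s t th = M * (1 * C - 0 * S)); last by rewrite mul0r subr0 mul1r.
  rewrite (_ : (fun n => _) = fun n => M *
      (binfactor s t th (partcos s th n t) (partsin s th n t) * C -
       binfactor s t th (partsin s th n t) (- partcos s th n t) * S)).
    by apply: cvgMl_tmp; apply: cvgB; exact: cvgMr_tmp.
  apply/funext => n; rewrite /binfactor -/C -/S -[LHS]mul1r -[in LHS]MV.
  by rewrite -[in LHS](mulr1 (partcos s th n t)) -cs; ring.
- rewrite (_ : powsin s t th = M * (1 * S + 0 * C)); last by rewrite mul0r addr0 mul1r.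
  rewrite (_ : (fun n => _) = fun n => M *
      (binfactor s t th (partcos s th n t) (partsin s th n t) * S +
       binfactor s t th (partsin s th n t) (- partcos s th n t) * C)).
    by apply: cvgMl_tmp; apply: cvgD; exact: cvgMr_tmp.
  apply/funext => n; rewrite /binfactor -/C -/S -[LHS]mul1r -[in LHS]MV.
  by rewrite -[in LHS](mulr1 (partsin s th n t)) -cs; ring.
Qed.

End BinomialTheorem.

(** * Cauchy's coefficient formula on a half-circle *)

Lemma Rintegral_dominated_cvg (d : measure_display) (T : measurableType d)
    (R : realType) (mu : {measure set T -> \bar R}) (D : set T)
    (f_ : nat -> T -> R) (f g : T -> R) :
  measurable D -> (forall n, measurable_fun D (f_ n)) ->
  (forall x, D x -> f_ n x @[n --> \oo] --> f x) ->
  mu.-integrable D (EFin \o g) ->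
  (forall n x, D x -> `|f_ n x| <= g x) ->
  (\int[mu]_(x in D) f_ n x)%R @[n --> \oo] --> (\int[mu]_(x in D) f x)%R.
Proof.
move=> mD mf ff ig fg.
have mfE n : measurable_fun D (EFin \o f_ n) by exact/measurable_EFinP.
have ffE x : D x -> (f_ n x)%:E @[n --> \oo] --> (f x)%:E.
  by move=> Dx; apply/fine_cvgP; split; [exact: nearW|exact: ff].
have fing x : D x -> (g x)%:E \is a fin_num by [].
have fgE n x : D x -> (`|(f_ n x)%:E| <= (g x)%:E)%E.
  by move=> Dx; rewrite lee_fin fg.
have h := dominated_cvg mD mfE ffE fing ig fgE.
have i := lebesgue_integral_dominated_convergence.dominated_integrable
  mD _ _ _ mfE ffE ig fgE.
apply: fine_cvg; rewrite fineK; first exact: h.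
exact: integrable_fin_num.
Qed.

Section Fourier.
Variable R : realType.
Implicit Types (s t th : R) (n m k : nat).
Let mu := @lebesgue_measure R.

Lemma continuous_mull (a : R) : continuous (fun x : R => a * x).
Proof. by move=> x; apply: cvgM; [exact: cvg_cst|exact: cvg_id]. Qed.

Lemma continuous_cos_mull (a : R) : continuous (fun th : R => cos (a * th)).
Proof.
by move=> x; apply: continuous_comp; [exact: continuous_mull|exact: continuous_cos].
Qed.

Lemma continuous_sin_mull (a : R) : continuous (fun th : R => sin (a * th)).
Proof.
by move=> x; apply: continuous_comp; [exact: continuous_mull|exact: continuous_sin].
Qed.

Lemma continuous_normsq t : continuous (normsq t).
Proof.
move=> x; apply: cvgD; last exact: cvg_cst.
apply: cvgB; first exact: cvg_cst.
by apply: cvgM; [exact: cvg_cst|exact: continuous_cos].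
Qed.

Lemma continuous_phase t : 0 <= t < 1 -> continuous (phase t).
Proof.
move=> t01 x; apply: (@continuous_comp _ _ _
  (fun th : R => t * sin th / (1 - t * cos th)) (@atan R)); last exact: continuous_atan.
apply: cvgM; first by apply: cvgM; [exact: cvg_cst|exact: continuous_sin].
apply: cvgV; first by rewrite gt_eqF// tcos_lt1.
apply: cvgB; first exact: cvg_cst.
by apply: cvgM; [exact: cvg_cst|exact: continuous_cos].
Qed.

Lemma continuous_powmod s t : 0 <= t < 1 ->
  continuous (fun th => expR (- (s / 2) * ln (normsq t th))).
Proof.
move=> t01 x.
apply: (@continuous_comp _ _ _ (fun th : R => - (s / 2) * ln (normsq t th)) (@expR R));
  last exact: continuous_expR.
apply: cvgM; first exact: cvg_cst.
apply: (@continuous_comp _ _ _ (normsq t) (@ln R)); first exact: continuous_normsq.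
exact/continuous_ln/normsq_gt0.
Qed.

Lemma continuous_powcos s t : 0 <= t < 1 -> continuous (powcos s t).
Proof.
move=> t01 x; apply: cvgM; first exact: continuous_powmod.
apply: (@continuous_comp _ _ _ (phase t) (fun y => cos (s * y))).
  exact: continuous_phase.
exact: continuous_cos_mull.
Qed.

Lemma continuous_powsin s t : 0 <= t < 1 -> continuous (powsin s t).
Proof.
move=> t01 x; apply: cvgM; first exact: continuous_powmod.
apply: (@continuous_comp _ _ _ (phase t) (fun y => sin (s * y))).
  exact: continuous_phase.
exact: continuous_sin_mull.
Qed.

Lemma continuous_integrable (f : R -> R) (a b : R) : continuous f ->
  mu.-integrable `[a, b] (EFin \o f).
Proof.
move=> cf; apply: continuous_compact_integrable; first exact: segment_compact.
exact: continuous_subspaceT.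
Qed.

Lemma sin_natpi n : sin (n%:R * pi) = 0 :> R.
Proof.
elim: n => [|n IH]; first by rewrite mul0r sin0.
by rewrite -natr1 mulrDl mul1r sinDpi IH oppr0.
Qed.

Lemma cos_mode_continuous (a b : nat) :
  continuous (fun th : R => cos (a%:R * th - b%:R * th)).
Proof.
under [X in continuous X]eq_fun do rewrite -mulrBl.
exact: continuous_cos_mull.
Qed.

(** Orthogonality of the characters on the half-circle, which suffices since
    only real parts occur. *)
Lemma integral_cos_mode (a b : nat) :
  (\int[mu]_(th in `[0, pi]) cos (a%:R * th - b%:R * th))%R =
  (if a == b then pi else 0) :> R.
Proof.
have [->|ab] := eqVneq a b.
  under eq_Rintegral do rewrite subrr cos0.
  rewrite Rintegral_cst//= lebesgue_measure_itv/= lte_fin pi_gt0/=.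
  by rewrite subr0 mul1r.
have c0 : a%:R - b%:R != 0 :> R by rewrite subr_eq0 eqr_nat.
set c : R := a%:R - b%:R in c0.
have dF (x : R) : is_derive x 1 (fun th : R => sin (c * th) / c) (cos (c * x)).
  have d1 : is_derive x 1 (fun th : R => c * th) c.
    by apply: is_derive_eq; rewrite /GRing.scale/=; ring.
  have d2 := @is_derive1_comp _ (@sin R) (fun u => c * u) _ _ _ (is_derive_sin _) d1.
  have d3 := is_deriveM d2 (is_derive_cst (c^-1 : R) x (1 : R)).
  by apply: (is_derive_eq d3); rewrite /GRing.scale/=; field.
have cF x : {for x, continuous (fun th : R => sin (c * th) / c)}.
  by apply/differentiable_continuous/derivable1_diffP; apply: ex_derive.
rewrite /Rintegral.
under eq_integral do rewrite -mulrBl -/c.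
rewrite (@continuous_FTC2 _ (fun th => cos (c * th)) (fun th => sin (c * th) / c));
  last first.
- by move=> x _; rewrite derive1E derive_val.
- split.
  + by move=> x _; apply: ex_derive.
  + by apply: cvg_at_right_filter; exact: cF.
  + by apply: cvg_at_left_filter; exact: cF.
- apply: continuous_subspaceT; exact: continuous_cos_mull.
- exact: pi_gt0.
by rewrite /= mulr0 sin0 mul0r subr0 /c mulrBl sinB !sin_natpi mul0r mulr0 subrr mul0r.
Qed.

Lemma partcosS s th n t :
  partcos s th n.+1 t = partcos s th n t + rising s n * t ^+ n * cos (n%:R * th).
Proof. by rewrite /partcos big_ord_recr. Qed.

Lemma partsinS s th n t :
  partsin s th n.+1 t = partsin s th n t + rising s n * t ^+ n * sin (n%:R * th).
Proof. by rewrite /partsin big_ord_recr. Qed.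

Lemma continuous_partcos s t n : continuous (fun th => partcos s th n t).
Proof.
elim: n => [|n IH].
  rewrite (_ : (fun _ => _) = fun=> 0); first exact: cst_continuous.
  by apply/funext => x; rewrite /partcos big_ord0.
have -> : (fun th => partcos s th n.+1 t) =
    fun th => partcos s th n t + rising s n * t ^+ n * cos (n%:R * th).
  by apply/funext => x; exact: partcosS.
move=> x; apply: cvgD; first exact: IH.
by apply: cvgM; [exact: cvg_cst|exact: continuous_cos_mull].
Qed.

Lemma continuous_partsin s t n : continuous (fun th => partsin s th n t).
Proof.
elim: n => [|n IH].
  rewrite (_ : (fun _ => _) = fun=> 0); first exact: cst_continuous.
  by apply/funext => x; rewrite /partsin big_ord0.
have -> : (fun th => partsin s th n.+1 t) =
    fun th => partsin s th n t + rising s n * t ^+ n * sin (n%:R * th).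
  by apply/funext => x; exact: partsinS.
move=> x; apply: cvgD; first exact: IH.
by apply: cvgM; [exact: cvg_cst|exact: continuous_sin_mull].
Qed.

Lemma norm_partcos_le s t n th : 0 <= t < 1 ->
  `|partcos s th n t| <= rising_bound s t.
Proof.
move=> t01; apply: le_trans (sum_norm_rising_le s n t01).
apply: le_trans (ler_norm_sum _ _ _) _; apply: ler_sum => k _.
rewrite !normrM -[leRHS]mulr1; apply: ler_pM => //; last exact: cos_max.
by rewrite ler_wpM2l// ger0_norm// exprn_ge0//; case/andP: t01.
Qed.

Lemma norm_partsin_le s t n th : 0 <= t < 1 ->
  `|partsin s th n t| <= rising_bound s t.
Proof.
move=> t01; apply: le_trans (sum_norm_rising_le s n t01).
apply: le_trans (ler_norm_sum _ _ _) _; apply: ler_sum => k _.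
rewrite !normrM -[leRHS]mulr1; apply: ler_pM => //; last exact: sin_max.
by rewrite ler_wpM2l// ger0_norm// exprn_ge0//; case/andP: t01.
Qed.

(** Termwise integration of the real part of
    [(1 - v)^(-s) (f + i g)] over the half-circle [|v| = t]. *)
Lemma integral_binomial_series s t (f g : R -> R) : 0 <= t < 1 ->
  continuous f -> continuous g ->
  \sum_(k < n) rising s k * t ^+ k *
    (\int[mu]_(th in `[0, pi]) (cos (k%:R * th) * f th - sin (k%:R * th) * g th))%R
    @[n --> \oo] -->
  (\int[mu]_(th in `[0, pi]) (powcos s t th * f th - powsin s t th * g th))%R.
Proof.
move=> t01 cf cg.
pose F n th := partcos s th n t * f th - partsin s th n t * g th.
have cterm k : continuous (fun th => cos (k%:R * th) * f th - sin (k%:R * th) * g th).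
  move=> x; apply: cvgB; apply: cvgM; [exact: continuous_cos_mull|exact: cf|
    exact: continuous_sin_mull|exact: cg].
have cF n : continuous (F n).
  move=> x; apply: cvgB; apply: cvgM; [exact: continuous_partcos|exact: cf|
    exact: continuous_partsin|exact: cg].
have -> : (fun n => \sum_(k < n) rising s k * t ^+ k *
    (\int[mu]_(th in `[0, pi]) (cos (k%:R * th) * f th - sin (k%:R * th) * g th))%R)
    = fun n => (\int[mu]_(th in `[0, pi]) F n th)%R.
  apply/funext; elim => [|n IH].
    rewrite big_ord0; under eq_Rintegral do
      rewrite /F /partcos /partsin !big_ord0 !mul0r subrr.
    by rewrite Rintegral_cst//= mul0r.
  rewrite big_ord_recr/= IH -RintegralZl//; last exact: continuous_integrable.
  rewrite -RintegralD//; last 2 first.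
  - exact: continuous_integrable.
  - apply: continuous_integrable => x.
    by apply: cvgM; [exact: cvg_cst|exact: cterm].
  by apply: eq_Rintegral => th _; rewrite /F partcosS partsinS; ring.
pose B := rising_bound s t.
apply: (@Rintegral_dominated_cvg _ (measurableTypeR R) R mu `[0, pi]%classic F _
  (fun th => B * `|f th| + B * `|g th|)) => //.
- move=> n; apply: measurable_funTS; exact: continuous_measurable_fun.
- move=> th _; have [hc hs] := binomial_series s th t01.
  by apply: cvgB; apply: cvgMr_tmp.
- apply: continuous_integrable => x.
  by apply: cvgD; apply: cvgM; [exact: cvg_cst|apply: cvg_norm; exact: cf|
    exact: cvg_cst|apply: cvg_norm; exact: cg].
- move=> n th _; apply: le_trans (ler_normB _ _) _.
  rewrite !normrM lerD// ler_wpM2r//; [exact: norm_partcos_le|exact: norm_partsin_le].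
Qed.

Lemma cvg_finite_sum (F : nat -> R) N : (forall k, (N <= k)%N -> F k = 0) ->
  \sum_(k < n) F k @[n --> \oo] --> \sum_(k < N) F k.
Proof.
move=> F0; rewrite -(cvg_shiftn N)/=.
rewrite (_ : (fun _ => _) = fun=> \sum_(k < N) F k); first exact: cvg_cst.
apply/funext => n /=; rewrite addnC big_split_ord/= [X in _ + X]big1 ?addr0// => i _.
by rewrite F0// leq_addr.
Qed.

(** Cauchy's coefficient formula for [(1 - v)^(-s) (1 - w)^(-m)] on the circle,
    where [|v| = t], [|w| = u] and [v], [w] have the same argument [th]: both
    binomial series are integrated term by term against [e^(- i n th)]. *)
Lemma coefficient_integral s (m : R) t (u : R) n :
  0 <= t < 1 -> 0 <= u < 1 ->
  (\int[mu]_(th in `[0, pi])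
    (expR (- (s / 2) * ln (normsq t th)) * expR (- (m / 2) * ln (normsq u th)) *
     cos (s * phase t th + m * phase u th - n%:R * th)))%R =
  pi * \sum_(j < n.+1) (rising s j * t ^+ j) * (rising m (n - j) * u ^+ (n - j)).
Proof.
move=> t01 u01.
pose f th := powcos m u th * cos (n%:R * th) + powsin m u th * sin (n%:R * th).
pose g th := powsin m u th * cos (n%:R * th) - powcos m u th * sin (n%:R * th).
have cf : continuous f.
  move=> x; apply: cvgD; apply: cvgM; [exact: continuous_powcos|
    exact: continuous_cos_mull|exact: continuous_powsin|exact: continuous_sin_mull].
have cg : continuous g.
  move=> x; apply: cvgB; apply: cvgM; [exact: continuous_powsin|
    exact: continuous_cos_mull|exact: continuous_powcos|exact: continuous_sin_mull].
pose J j :=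
  (\int[mu]_(th in `[0, pi]) (cos (j%:R * th) * f th - sin (j%:R * th) * g th))%R.
have JE j : J j = if (j <= n)%N then pi * (rising m (n - j) * u ^+ (n - j)) else 0.
  pose c th := cos (j%:R * th - n%:R * th) : R.
  pose d th := sin (j%:R * th - n%:R * th) : R.
  have cc : continuous c by exact: cos_mode_continuous.
  have cd : continuous d.
    rewrite /d; under [X in continuous X]eq_fun do rewrite -mulrBl.
    exact: continuous_sin_mull.
  have h := integral_binomial_series (s := m) u01 cc cd.
  have e1 : J j =
    (\int[mu]_(th in `[0, pi]) (powcos m u th * c th - powsin m u th * d th))%R.
    by apply: eq_Rintegral => th _; rewrite /f /g /c /d cosB sinB; ring.
  rewrite -e1 in h.
  pose F i := rising m i * u ^+ i * (if (i + j == n)%N then pi else 0).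
  have e2 : (fun N => \sum_(i < N) rising m i * u ^+ i *
      (\int[mu]_(th in `[0, pi]) (cos (i%:R * th) * c th - sin (i%:R * th) * d th))%R)
      = fun N => \sum_(i < N) F i.
    apply/funext => N; apply: eq_bigr => i _; congr (_ * _).
    rewrite -integral_cos_mode; apply: eq_Rintegral => th _.
    by rewrite /c /d -cosD; congr cos; rewrite natrD; ring.
  rewrite e2 in h.
  (* only the index i = n - j survives, by orthogonality *)
  have h2 : \sum_(i < N) F i @[N --> \oo] --> \sum_(i < n.+1) F i.
    apply: cvg_finite_sum => i ni; rewrite /F ifF ?mulr0//.
    by apply/negbTE; rewrite neq_ltn (leq_trans ni) ?orbT// leq_addr.
  rewrite (cvg_unique _ h h2)//.
  case: leqP => jn.
    have jn1 : (n - j < n.+1)%N by rewrite ltnS leq_subr.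
    rewrite (bigD1 (Ordinal jn1))//= big1 => [|[i /= Hi] /eqP ij].
      by rewrite /F subnK// eqxx addr0 mulrC.
    rewrite /F ifF ?mulr0//; apply/negbTE/eqP => ijn; apply: ij.
    by apply: val_inj => /=; rewrite -ijn addnK.
  rewrite big1// => -[i /= Hi] _; rewrite /F ifF ?mulr0//; apply/negbTE.
  by rewrite neq_ltn (leq_trans jn) ?orbT// leq_addl.
have h := integral_binomial_series (s := s) t01 cf cg.
have h2 : \sum_(j < N) rising s j * t ^+ j * J j @[N --> \oo] -->
    \sum_(j < n.+1) rising s j * t ^+ j * J j.
  by apply: (cvg_finite_sum (F := fun j => rising s j * t ^+ j * J j)) => j nj;
    rewrite JE leqNgt nj/= mulr0.
have := cvg_unique _ h h2 => e.
transitivity (\int[mu]_(th in `[0, pi]) (powcos s t th * f th - powsin s t th * g th))%R.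
  apply: eq_Rintegral => th _.
  rewrite /f /g /powcos /powsin cosB cosD sinD; ring.
rewrite e// mulr_sumr; apply: eq_bigr => -[j /= jn] _.
by rewrite JE -ltnS jn; ring.
Qed.

End Fourier.

(** * Estimates for phase and modulus near the positive axis *)

Section LocalEstimates.
Variable R : realType.
Implicit Types (t x th : R).

Lemma mvt_derive (f df : R -> R) x : 0 <= x ->
  (forall y : R, 0 <= y <= x -> is_derive y 1 f (df y)) ->
  exists2 c, 0 <= c <= x & f x - f 0 = df c * x.
Proof.
move=> x0 fdf.
have cf : {within `[0, x], continuous f}.
  apply: derivable_within_continuous => y; rewrite in_itv/= => yx.
  exact/(@ex_derive _ _ _ _ _ _ _ (fdf y yx)).
have fdf' (y : R) : y \in `]0, x[ -> is_derive y 1 f (df y).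
  by rewrite in_itv/= => /andP[y0 yx]; apply: fdf; rewrite !ltW.
have [c] := MVT_segment x0 fdf' cf.
by rewrite in_itv/= subr0 => c0x ->; exists c.
Qed.

Lemma sin_le_id x : 0 <= x -> `|sin x| <= x.
Proof.
move=> x0; have [c _] := mvt_derive x0 (fun y _ => is_derive_sin y).
rewrite sin0 subr0 => ->; rewrite normrM (ger0_norm x0) ler_piMl//.
exact: cos_max.
Qed.

Lemma onem_cos_half th : 1 - cos th = 2 * sin (th / 2) ^+ 2.
Proof.
have -> : cos th = cos ((th / 2) *+ 2) by congr cos; rewrite mulr2n; field.
by rewrite cos_mulr2n sin2cos2; ring.
Qed.

Lemma onem_cos_ge0 th : 0 <= 1 - cos th.
Proof. by rewrite subr_ge0 cos_le1. Qed.

Lemma onem_cos_le th : 0 <= th -> 1 - cos th <= th ^+ 2 / 2.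
Proof.
move=> th0; rewrite onem_cos_half.
have h0 : 0 <= th / 2 by rewrite divr_ge0.
have : sin (th / 2) ^+ 2 <= (th / 2) ^+ 2.
  by rewrite -real_normK ?num_real// lerXn2r ?nnegrE ?normr_ge0// sin_le_id.
by move=> h; lra.
Qed.

Lemma sin_sub_id x : 0 <= x -> `|sin x - x| <= x ^+ 3 / 2.
Proof.
move=> x0.
have d (y : R) : is_derive y 1 (fun y => sin y - y) (cos y - 1).
  by apply: is_derive_eq.
have [c /andP[c0 cx]] := mvt_derive x0 (fun y _ => d y).
rewrite sin0 !subr0 => ->; rewrite normrM (ger0_norm x0).
rewrite (_ : x ^+ 3 / 2 = x ^+ 2 / 2 * x); last by ring.
apply: ler_wpM2r => //; rewrite distrC ger0_norm ?onem_cos_ge0//.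
apply: le_trans (onem_cos_le c0) _.
by rewrite ler_wpM2r// lerXn2r ?nnegrE.
Qed.

Lemma onem_cos_approx th : 0 <= th -> `|1 - cos th - th ^+ 2 / 2| <= th ^+ 4 / 8.
Proof.
move=> th0; rewrite onem_cos_half; set h := th / 2.
have h0 : 0 <= h by rewrite divr_ge0.
have -> : 2 * sin h ^+ 2 - th ^+ 2 / 2 = 2 * ((sin h - h) * (sin h + h)).
  by rewrite /h; field.
rewrite normrM (ger0_norm (ler0n _ 2)) normrM.
rewrite (_ : th ^+ 4 / 8 = 2 * ((h ^+ 3 / 2) * (h + h))); last by rewrite /h; field.
rewrite ler_wpM2l// ler_pM//; first exact: sin_sub_id.
by apply: le_trans (ler_normD _ _) _; rewrite (ger0_norm h0) lerD2r sin_le_id.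
Qed.

Lemma cos_pi4_sqr : cos (pi / 4) ^+ 2 = 1 / 2 :> R.
Proof.
have : cos ((pi / 4) *+ 2) = 0 :> R.
  by rewrite -[RHS]cos_pihalf; congr cos; rewrite mulr2n; field.
by rewrite cos_mulr2n mulr2n => h; lra.
Qed.

(** Jordan's inequality with a crude constant: halve the angle twice. *)
Lemma onem_cos_ge th : 0 <= th <= pi -> th ^+ 2 / 8 <= 1 - cos th.
Proof.
move=> /andP[th0 thpi]; rewrite onem_cos_half.
set k := cos (pi / 4) : R.
have p0 : 0 < pi :> R by exact: pi_gt0.
have k0 : 0 <= k.
  by apply: cos_ge0_pihalf; apply/andP; split; lra.
have ck c : 0 <= c <= th / 4 -> k <= cos c.
  move=> /andP[c0 c4].
  rewrite /k leNgt; apply/negP => h.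
  have := @ltr_cos R (pi / 4) c; rewrite !in_itv/=.
  have -> : 0 <= (pi / 4 : R) <= pi by apply/andP; split; lra.
  have -> : 0 <= c <= pi by apply/andP; split; lra.
  by move=> /(_ erefl erefl); rewrite h => /esym; lra.
have x0 : 0 <= th / 4 by lra.
have [c c4] := mvt_derive x0 (fun y _ => is_derive_sin y).
rewrite sin0 subr0 => sE.
have s2 : sin (th / 2) = 2 * (cos (th / 4) * sin (th / 4)).
  have -> : th / 2 = (th / 4) *+ 2 by rewrite mulr2n; field.
  by rewrite sin_mulr2n mulr2n; ring.
have h1 : th / 4 <= sin (th / 2).
  rewrite s2 sE; have k1 := ck _ c4.
  have k2 : k <= cos (th / 4) by apply: ck; rewrite x0 lexx.
  have kk : k * k <= cos (th / 4) * cos c by apply: ler_pM.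
  have : k * k = 1 / 2 by rewrite -expr2 cos_pi4_sqr.
  by move=> kE; rewrite kE in kk; nra.
by nra.
Qed.

Lemma is_derive_phase_angle t th : 0 <= t < 1 ->
  is_derive th 1 (phase t) ((t * cos th - t ^+ 2) / normsq t th).
Proof.
move=> t01; have u0 := tcos_lt1 th t01; have d0 := normsq_gt0 th t01.
have un0 : 1 - t * cos th != 0 by rewrite gt_eqF.
have dn0 : normsq t th != 0 by rewrite gt_eqF.
have dq : is_derive th 1 (fun th => t * sin th / (1 - t * cos th))
    ((t * cos th - t ^+ 2) / (1 - t * cos th) ^+ 2).
  apply: is_derive_eq; rewrite /GRing.scale/=.
  transitivity ((t * cos th - t ^+ 2 * (cos th ^+ 2 + sin th ^+ 2))
    / (1 - t * cos th) ^+ 2); last by rewrite cos2Dsin2 mulr1.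
  by field.
have da := is_derive1_comp (is_derive1_atan _) dq; apply: (is_derive_eq da).
rewrite normsqE in dn0 *.
have h : 1 + (t * sin th / (1 - t * cos th)) ^+ 2 =
   ((1 - t * cos th) ^+ 2 + (t * sin th) ^+ 2) / (1 - t * cos th) ^+ 2 by field.
by rewrite h /GRing.scale/=; field; rewrite un0 dn0.
Qed.

Lemma phase_angle0 t : phase t 0 = 0.
Proof. by rewrite /phase sin0 mulr0 mul0r atan0. Qed.

Lemma normsq_onem_cos t th : normsq t th = (1 - t) ^+ 2 + 2 * t * (1 - cos th).
Proof. by rewrite /normsq; ring. Qed.

(** The phase is odd and smooth in the angle, hence linear up to a cubic error. *)
Lemma phase_approx t th : 0 <= t < 1 -> 0 <= th ->
  `|phase t th - t / (1 - t) * th| <= (1 - t) ^- 3 * th ^+ 3.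
Proof.
move=> t01 th0; have /andP[t0 t1] := t01.
have u0 : 0 < 1 - t by rewrite subr_gt0.
have un0 : 1 - t != 0 by rewrite gt_eqF.
have d (y : R) : is_derive y 1 (fun y => phase t y - t / (1 - t) * y)
    ((t * cos y - t ^+ 2) / normsq t y - t / (1 - t)).
  have dp := is_derive_phase_angle y t01.
  have dl : is_derive y 1 (fun y : R => t / (1 - t) * y) (t / (1 - t)).
    by apply: is_derive_eq; rewrite /GRing.scale/=; ring.
  exact: is_deriveB.
have [c /andP[c0 cx]] := mvt_derive th0 (fun y _ => d y).
rewrite phase_angle0 mulr0 !subr0 => ->; rewrite normrM (ger0_norm th0).
rewrite (_ : (1 - t) ^- 3 * th ^+ 3 = (1 - t) ^- 3 * th ^+ 2 * th); last first.
  by rewrite -mulrA -exprSr.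
apply: ler_wpM2r => //.
have n0 := normsq_gt0 c t01; have nn0 : normsq t c != 0 by rewrite gt_eqF.
have -> : (t * cos c - t ^+ 2) / normsq t c - t / (1 - t) =
   - (t * (1 + t) * (1 - cos c) / ((1 - t) * normsq t c)).
  rewrite normsq_onem_cos in nn0 *.
  by field; rewrite un0 nn0.
have x0 := onem_cos_ge0 c.
rewrite normrN ger0_norm; last first.
  by rewrite divr_ge0// mulr_ge0 ?(ltW u0) ?(ltW n0)// mulr_ge0// addr_ge0.
rewrite ler_pdivrMr ?mulr_gt0//.
have hn := normsq_ge c t0.
have hc : 1 - cos c <= th ^+ 2 / 2.
  apply: le_trans (onem_cos_le c0) _.
  by rewrite ler_wpM2r// lerXn2r ?nnegrE.
apply: (@le_trans _ _ (th ^+ 2)).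
  have : t * (1 + t) <= 2 by nra.
  have : 0 <= t * (1 + t) by nra.
  by nra.
rewrite [leRHS](_ : _ = th ^+ 2 * (normsq t c / (1 - t) ^+ 2)); last by field.
by rewrite ler_peMr ?sqr_ge0// ler_pdivlMr ?exprn_gt0// mul1r.
Qed.

Definition log_growth t th : R := ln (normsq t th) - ln (normsq t 0).

Lemma log_growthE t th : 0 <= t < 1 ->
  log_growth t th = ln (1 + 2 * t / (1 - t) ^+ 2 * (1 - cos th)).
Proof.
move=> t01; rewrite /log_growth -ln_div ?posrE ?normsq_gt0//; congr ln.
rewrite !normsq_onem_cos cos0 subrr mulr0 addr0.
have /andP[t0 t1] := t01.
by field; rewrite gt_eqF// subr_gt0.
Qed.

Lemma is_derive_ln_affine (B y : R) : 0 <= B -> 0 <= y ->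
  is_derive y 1 (fun y => ln (1 + B * y)) (B / (1 + B * y)).
Proof.
move=> B0 y0.
have p : 0 < 1 + B * y by rewrite ltr_pwDl// mulr_ge0.
have dl : is_derive y 1 (fun y : R => 1 + B * y) B.
  by apply: is_derive_eq; rewrite /GRing.scale/=; ring.
have := @is_derive1_comp _ (@ln R) (fun y => 1 + B * y) _ _ _ (is_derive1_ln p) dl.
by move=> d; apply: (is_derive_eq d); rewrite mulrC.
Qed.

Lemma ln_affine_approx (B x : R) : 0 <= B -> 0 <= x ->
  `|ln (1 + B * x) - B * x| <= B ^+ 2 * x ^+ 2.
Proof.
move=> B0 x0.
have d (y : R) : 0 <= y <= x ->
    is_derive y 1 (fun y => ln (1 + B * y) - B * y) (B / (1 + B * y) - B).
  move=> /andP[y0 _]; have dl := is_derive_ln_affine B0 y0.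
  have dm : is_derive y 1 (fun y : R => B * y) B.
    by apply: is_derive_eq; rewrite /GRing.scale/=; ring.
  exact: is_deriveB.
have [c /andP[c0 cx]] := mvt_derive x0 d.
rewrite mulr0 addr0 ln1 !subr0 => ->; rewrite normrM (ger0_norm x0).
rewrite [leRHS](_ : _ = B ^+ 2 * x * x); last by ring.
apply: ler_wpM2r => //.
have p : 0 < 1 + B * c by rewrite ltr_pwDl// mulr_ge0.
have -> : B / (1 + B * c) - B = - (B ^+ 2 * c / (1 + B * c)).
  by field; rewrite gt_eqF.
rewrite normrN ger0_norm ?divr_ge0 ?(ltW p) ?mulr_ge0 ?sqr_ge0//.
rewrite ler_pdivrMr//; apply: (@le_trans _ _ (B ^+ 2 * x)).
  by rewrite ler_wpM2l// sqr_ge0.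
by rewrite ler_peMr ?mulr_ge0 ?sqr_ge0// lerDl mulr_ge0.
Qed.

Lemma log_growth_approx t th : 0 <= t < 1 -> 0 <= th ->
  `|log_growth t th - t / (1 - t) ^+ 2 * th ^+ 2| <=
    ((2 * t / (1 - t) ^+ 2) ^+ 2 + 2 * t / (1 - t) ^+ 2) * th ^+ 4.
Proof.
move=> t01 th0; rewrite log_growthE//; have /andP[t0 t1] := t01.
set B := 2 * t / (1 - t) ^+ 2.
have B0 : 0 <= B by apply: divr_ge0; [exact: mulr_ge0|exact: sqr_ge0].
have x0 := onem_cos_ge0 th; have x1 := onem_cos_le th0.
have h1 := ln_affine_approx B0 x0; have h2 := onem_cos_approx th0.
set x := 1 - cos th in x0 x1 h1 h2 *.
have -> : t / (1 - t) ^+ 2 * th ^+ 2 = B * (th ^+ 2 / 2).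
  by rewrite /B; field; rewrite gt_eqF// subr_gt0.
have -> : ln (1 + B * x) - B * (th ^+ 2 / 2) =
   (ln (1 + B * x) - B * x) + B * (x - th ^+ 2 / 2) by ring.
apply: le_trans (ler_normD _ _) _; rewrite mulrDl; apply: lerD.
  apply: le_trans h1 _; rewrite ler_wpM2l ?sqr_ge0//.
  rewrite (_ : th ^+ 4 = (th ^+ 2) ^+ 2); last by rewrite -exprM.
  rewrite lerXn2r ?nnegrE ?sqr_ge0//; apply: le_trans x1 _.
  by have := sqr_ge0 th; lra.
rewrite normrM (ger0_norm B0) ler_wpM2l//; apply: le_trans h2 _.
have : 0 <= th ^+ 4 by rewrite exprn_ge0.
by lra.
Qed.

(** [x] stands for [1 - cos th]; as a function of [x] the exponent is monotone
    on [0, 2], because [b <= a] makes the derivative's numerator at most its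
    value at [0]. *)
Lemma log_exponent_le (a b A B x : R) : 0 <= b <= a -> 0 <= B -> 0 <= A ->
  b * B <= a * A -> 0 <= x <= 2 ->
  b * ln (1 + B * x) - a * ln (1 + A * x) <=
    - ((a * A - b * B) / ((1 + 2 * B) * (1 + 2 * A))) * x.
Proof.
move=> /andP[b0 ba] B0 A0 aAbB /andP[x0 x2].
have d (y : R) : 0 <= y <= x ->
    is_derive y 1 (fun y => b * ln (1 + B * y) - a * ln (1 + A * y))
     (b * (B / (1 + B * y)) - a * (A / (1 + A * y))).
  move=> /andP[y0 _].
  have d1 := is_deriveZ b (is_derive_ln_affine B0 y0).
  have d2 := is_deriveZ a (is_derive_ln_affine A0 y0).
  exact: is_deriveB.
have [c /andP[c0 cx]] := mvt_derive x0 d.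
rewrite !mulr0 !addr0 ln1 !mulr0 !subr0 => ->; apply: ler_wpM2r => //.
have p1 : 0 < 1 + B * c by rewrite ltr_pwDl// mulr_ge0.
have p2 : 0 < 1 + A * c by rewrite ltr_pwDl// mulr_ge0.
have -> : b * (B / (1 + B * c)) - a * (A / (1 + A * c)) =
   - ((a * A - b * B + (a - b) * A * B * c) / ((1 + B * c) * (1 + A * c))).
  by field; rewrite !gt_eqF.
rewrite lerN2; apply: ler_pM.
- by rewrite subr_ge0.
- by rewrite invr_ge0 mulr_ge0// addr_ge0// mulr_ge0.
- by rewrite lerDl !mulr_ge0// subr_ge0.
- rewrite lef_pV2 ?posrE ?mulr_gt0 ?ltr_pwDl ?mulr_ge0//.
  have c2 := le_trans cx x2.
  by apply: ler_pM; [exact: ltW|exact: ltW| |]; rewrite lerD2l mulrC ler_wpM2r.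
Qed.

End LocalEstimates.

(** * Laplace's method *)

Section Laplace.
Variable R : realType.
Implicit Types (s th : R) (n : nat).
Let mu := @lebesgue_measure R.

Lemma integral_rescale (h : R -> R) (a d : R) : 0 < d -> 0 <= a ->
  continuous h ->
  (\int[mu]_(th in `[0, a]) h th)%R =
  d * (\int[mu]_(s in `[0, a / d]) h (d * s))%R.
Proof.
move=> d0 a0 ch.
have dF (x : R) : is_derive x 1 (fun s : R => d * s) d.
  by apply: is_derive_eq; rewrite /GRing.scale/=; ring.
have F' : derive1 (fun s : R => d * s) = fun=> d.
  by apply/funext => x; rewrite derive1E derive_val.
have cF : continuous (fun s : R => d * s) by exact: continuous_mull.
have chF : continuous (fun s => h (d * s)).
  by move=> x; apply: continuous_comp; [exact: cF|exact: ch].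
have ad0 : 0 <= a / d by rewrite divr_ge0// ltW.
have := @integration_by_substitution_increasing R (fun s => d * s) h 0 (a / d) ad0.
rewrite mulr0 mulrCA divff ?gt_eqF// mulr1 F' => sub.
rewrite -RintegralZl//; last exact: continuous_integrable.
rewrite /Rintegral sub.
- by congr fine; apply: eq_integral => x _; rewrite /= mulrC.
- by move=> x y _ _; rewrite ltr_pM2l.
- by move=> x _; exact: cst_continuous.
- exact: is_cvg_cst.
- exact: is_cvg_cst.
- split.
  + by move=> x _; apply: ex_derive.
  + by apply: cvg_at_right_filter; exact: cF.
  + by apply: cvg_at_left_filter; exact: cF.
- exact: continuous_subspaceT.
Qed.

Lemma integrable_oneDsqrV (C : R) :
  mu.-integrable `[0, +oo[ (EFin \o (fun s => C * (oneDsqr s)^-1)).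
Proof.
rewrite (_ : EFin \o _ = (fun s => C%:E * ((oneDsqr s)^-1)%:E)%E); last first.
  by apply/funext => s /=; rewrite EFinM.
apply: integrableZl => //; apply/integrableP; split.
  apply/measurable_EFinP; apply: measurable_funTS.
  exact: (continuous_measurable_fun continuous_oneDsqrV).
under eq_integral => s _ do rewrite gee0_abs ?lee_fin ?invr_ge0 ?(le_trans ler01)//.
by rewrite integral0y_oneDsqr ltry.
Qed.

Lemma cvg_invn_mul (C : R) : C / n.+1%:R @[n --> \oo] --> (0 : R).
Proof.
rewrite -(mulr0 C); apply: cvgMl_tmp.
exact: cvg_harmonic.
Qed.

(** Laplace's method at the endpoint [0]: after the scaling
    [th = s sqrt (2 / (S N))] the integrand converges pointwise to
    [A 0 e^(- s^2)] and is dominated by a multiple of [1 / (1 + s^2)]. *)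
Lemma laplace_method (G D A P : R -> R) (S c K M : R) :
  continuous G -> continuous D -> continuous A -> continuous P ->
  0 < S -> 0 < c ->
  (forall th, 0 <= th <= pi -> G th <= - (c * th ^+ 2)) ->
  (forall th, 0 <= th -> `|G th + S / 2 * th ^+ 2| <= K * th ^+ 4) ->
  (forall th, 0 <= th -> `|D th| <= K * th ^+ 3) ->
  (forall th, `|A th| <= M) -> P 0 = 0 ->
  Num.sqrt n.+1%:R * (\int[mu]_(th in `[0, pi])
     (expR (n.+1%:R * G th) * A th * cos (n.+1%:R * D th + P th)))%R
  @[n --> \oo] --> A 0 * (Num.sqrt (2 / S) * (Num.sqrt pi / 2)).
Proof.
move=> cG cD cA cP S0 c0 Gle Gapp Dapp AM P0.
have p0 := pi_gt0 R.
pose d n := Num.sqrt (2 / (S * n.+1%:R)).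
have N0 n : 0 < n.+1%:R :> R by rewrite ltr0n.
have d0 n : 0 < d n by rewrite sqrtr_gt0 divr_gt0// mulr_gt0.
have d2 n : d n ^+ 2 = 2 / S / n.+1%:R.
  rewrite sqr_sqrtr ?divr_ge0 ?mulr_ge0 ?ltW//.
  by field; rewrite gt_eqF// gt_eqF.
have Nd n : Num.sqrt n.+1%:R * d n = Num.sqrt (2 / S).
  rewrite /d -sqrtrM ?ltW//; congr Num.sqrt.
  by field; rewrite gt_eqF// gt_eqF.
pose h n th := expR (n.+1%:R * G th) * A th * cos (n.+1%:R * D th + P th).
have ch n : continuous (h n).
  move=> x; apply: cvgM; first apply: cvgM; last 1 first.
  - apply: (@continuous_comp _ _ _ (fun y => n.+1%:R * D y + P y) (@cos R)).
      by apply: cvgD; [apply: cvgM; [exact: cvg_cst|exact: cD]|exact: cP].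
    exact: continuous_cos.
  - apply: (@continuous_comp _ _ _ (fun y => n.+1%:R * G y) (@expR R)).
      by apply: cvgM; [exact: cvg_cst|exact: cG].
    exact: continuous_expR.
  - exact: cA.
pose H n := (fun s => h n (d n * s)) \_ `[0, pi / d n].
have HE n : (\int[mu]_(th in `[0, pi]) h n th)%R =
    d n * (\int[mu]_(s in `[0, +oo[) H n s)%R.
  rewrite (integral_rescale (d0 n) (ltW p0) (ch n)) /H -Rintegral_mkcondr.
  congr (_ * Rintegral _ _ _); apply/seteqP; split=> s /=; rewrite !in_itv/= ?andbT.
    by move=> /andP[s0 ->]; rewrite s0.
  by move=> [].
have -> : (fun n => Num.sqrt n.+1%:R * (\int[mu]_(th in `[0, pi])
     (expR (n.+1%:R * G th) * A th * cos (n.+1%:R * D th + P th)))%R) =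
   fun n => Num.sqrt (2 / S) * (\int[mu]_(s in `[0, +oo[) H n s)%R.
  by apply/funext => n; rewrite -(Nd n) -mulrA -HE.
have -> : A 0 * (Num.sqrt (2 / S) * (Num.sqrt pi / 2)) =
    Num.sqrt (2 / S) * (\int[mu]_(s in `[0, +oo[) (A 0 * gauss_fun s))%R.
  rewrite RintegralZl//; last first.
    by apply: integrableS integrableT_gauss.
  by rewrite /Rintegral integral0y_gauss/=; ring.
apply: cvgMl_tmp.
(* e^(- c N th^2) becomes e^(- c' s^2), and e^(- c' s^2) <= 1 / (1 + c' s^2) *)
pose c' := 2 * c / S.
have c'0 : 0 < c' by rewrite divr_gt0// mulr_gt0.
pose C := M * (1 + c'^-1).
have M0 : 0 <= M by apply: le_trans (AM 0).
apply: (@Rintegral_dominated_cvg _ (measurableTypeR R) R mu `[0, +oo[%classic H _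
  (fun s => C * (oneDsqr s)^-1)).
- by [].
- move=> n; apply/measurable_restrict => //.
  apply: measurable_funTS; apply: continuous_measurable_fun => x.
  by apply: continuous_comp; [exact: continuous_mull|exact: ch].
- move=> s; rewrite /= in_itv/= andbT => s0.
  have ds n : 0 <= d n * s by rewrite mulr_ge0// ltW.
  have dcvg : d n @[n --> \oo] --> (0 : R).
    have lim0 : 2 / (S * n.+1%:R) @[n --> \oo] --> (0 : R).
      rewrite (_ : (fun _ => _) = fun n : nat => 2 / S / n.+1%:R).
        exact: cvg_invn_mul.
      by apply/funext => n; field; rewrite gt_eqF// gt_eqF.
    rewrite -(@sqrtr0 R).
    exact: (continuous_cvg _ (@sqrt_continuous R 0) lim0).
  have dscvg : d n * s @[n --> \oo] --> (0 : R).
    by rewrite -(mul0r s); apply: cvgMr_tmp.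
  have lG : n.+1%:R * G (d n * s) @[n --> \oo] --> - s ^+ 2.
    apply/cvgrPdistC_lt => e e0.
    have := cvg_invn_mul (K * (2 / S) ^+ 2 * s ^+ 4).
    move=> /cvgr0Pnorm_lt /(_ _ e0); apply: filterS => n; apply: le_lt_trans.
    have := Gapp _ (ds n); rewrite -(ler_pM2l (N0 n)).
    rewrite -[X in X * `|_|](gtr0_norm (N0 n)) -normrM => /le_trans hh.
    rewrite (_ : _ - - s ^+ 2 = n.+1%:R * (G (d n * s) + S / 2 * (d n * s) ^+ 2)).
      apply: hh; apply: le_trans (ler_norm _).
      rewrite exprMn (_ : d n ^+ 4 = (d n ^+ 2) ^+ 2); last by rewrite -exprM.
      by rewrite d2 le_eqVlt; apply/orP; left; apply/eqP; field;
        rewrite !gt_eqF.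
    by rewrite exprMn d2; field; rewrite !gt_eqF.
  have lD : n.+1%:R * D (d n * s) @[n --> \oo] --> (0 : R).
    apply/cvgr0Pnorm_lt => e e0.
    have : K * (2 / S) * s ^+ 3 * d n @[n --> \oo] --> (0 : R).
      by rewrite -(mulr0 (K * (2 / S) * s ^+ 3)); exact: cvgMl_tmp.
    move=> /cvgr0Pnorm_lt /(_ _ e0); apply: filterS => n; apply: le_lt_trans.
    have := Dapp _ (ds n); rewrite -(ler_pM2l (N0 n)).
    rewrite -[X in X * `|_|](gtr0_norm (N0 n)) -normrM => /le_trans; apply.
    apply: le_trans (ler_norm _).
    rewrite exprMn exprS (d2 n).
    by rewrite le_eqVlt; apply/orP; left; apply/eqP; field; rewrite !gt_eqF.
  have lh : h n (d n * s) @[n --> \oo] --> A 0 * gauss_fun s.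
    rewrite (_ : A 0 * gauss_fun s = expR (- s ^+ 2) * A 0 * cos (0 + P 0)); last first.
      by rewrite P0 addr0 cos0 mulr1 mulrC.
    apply: cvgM; first apply: cvgM.
    + exact: (continuous_cvg _ (@continuous_expR R _) lG).
    + exact: (continuous_cvg _ (cA 0) dscvg).
    + apply: (continuous_cvg _ (@continuous_cos R _)); apply: cvgD => //.
      exact: (continuous_cvg _ (cP 0) dscvg).
  apply: cvg_trans lh; apply: near_eq_cvg.
  move/cvgr0Pnorm_lt : (dscvg) => /(_ _ p0); apply: filterS => n; rewrite ger0_norm// => dsp.
  rewrite /H patchE mem_set//= in_itv/= s0/= ler_pdivlMr// mulrC.
  exact: ltW.
- exact: integrable_oneDsqrV.
- move=> n s; rewrite /= in_itv/= andbT => s0.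
  have o0 : 0 < oneDsqr s by rewrite (lt_le_trans ltr01).
  have C0 : 0 <= C by rewrite mulr_ge0// addr_ge0// invr_ge0 ltW.
  rewrite /H patchE; case: ifPn => [|_]; last first.
    by rewrite normr0 mulr_ge0// invr_ge0 ltW.
  rewrite inE/= in_itv/= => /andP[_ sp].
  have ds : 0 <= d n * s <= pi.
    by rewrite mulr_ge0 ?(ltW (d0 n))//= mulrC -ler_pdivlMr.
  rewrite /h !normrM (ger0_norm (expR_ge0 _)) -[leRHS]mulr1.
  apply: ler_pM => //; last exact: cos_max.
  rewrite /C mulrC -mulrA; apply: ler_pM => //.
  apply: (@le_trans _ _ (expR (- (c' * s ^+ 2)))).
    rewrite ler_expR; apply: (@le_trans _ _ (n.+1%:R * - (c * (d n * s) ^+ 2))).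
      by rewrite ler_pM2l// Gle.
    rewrite exprMn d2 le_eqVlt; apply/orP; left; apply/eqP; rewrite /c'.
    by field; rewrite !gt_eqF.
  rewrite expRN.
  apply: (@le_trans _ _ (1 + c' * s ^+ 2)^-1).
    rewrite lef_pV2 ?posrE ?expR_gt0// ?expR_ge1Dx//.
    by rewrite ltr_pwDl// mulr_ge0 ?sqr_ge0// ltW.
  have q0 : 0 < 1 + c' * s ^+ 2 by rewrite ltr_pwDl// mulr_ge0 ?sqr_ge0// ltW.
  rewrite -[leLHS]mul1r ler_pdivrMr// mulrAC ler_pdivlMr// mul1r /oneDsqr.
  have e : (1 + c'^-1) * (1 + c' * s ^+ 2) = 1 + s ^+ 2 + c'^-1 + c' * s ^+ 2.
    by field; rewrite gt_eqF.
  rewrite e -addrA lerDl addr_ge0 ?invr_ge0 ?(ltW c'0)//.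
  by rewrite mulr_ge0 ?sqr_ge0// ltW.
Qed.

End Laplace.

(** * The coefficient integral near the saddle point *)

Section SaddlePoint.
Variable R : realType.
Implicit Types (r u a b z th : R) (n N : nat).
Let mu := @lebesgue_measure R.

(** With [v = r e^(i th)] and [w = u e^(i th)], the function
    [(1 - v)^b (1 - w)^(- a) e^(- i z th)] has modulus proportional to
    [exp saddle_growth] and argument [saddle_drift].  In the second-order
    expansion at [th = 0], [saddle_curvature] is the coefficient of
    [- th^2 / 2]. *)
Definition saddle_growth r u a b th : R :=
  b / 2 * log_growth r th - a / 2 * log_growth u th.
Definition saddle_drift r u a b z th : R :=
  a * phase u th - b * phase r th - z * th.
Definition saddle_amplitude u th : R := expR (- (1 / 2) * ln (normsq u th)).
Definition saddle_curvature r u a b : R :=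
  a * (u / (1 - u) ^+ 2) - b * (r / (1 - r) ^+ 2).

Lemma continuous_log_growth r : 0 <= r < 1 -> continuous (log_growth r).
Proof.
move=> r01 x; apply: cvgB; last exact: cvg_cst.
apply: (@continuous_comp _ _ _ (normsq r) (@ln R)); first exact: continuous_normsq.
exact/continuous_ln/normsq_gt0.
Qed.

Lemma ln_normsq0 r : 0 <= r < 1 -> ln (normsq r 0) = 2 * ln (1 - r).
Proof.
move=> /andP[r0 r1]; rewrite normsq_onem_cos cos0 subrr mulr0 addr0.
by rewrite lnXn ?subr_gt0// mulr2n; ring.
Qed.

Lemma saddle_amplitude0 u : 0 <= u < 1 -> saddle_amplitude u 0 = (1 - u)^-1.
Proof.
move=> u01; rewrite /saddle_amplitude ln_normsq0//.
rewrite (_ : - (1 / 2) * (2 * ln (1 - u)) = - ln (1 - u)); last by field.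
by rewrite expRN lnK// posrE subr_gt0; case/andP: u01.
Qed.

(** The equation for [z] says that the drift has no linear term, so that it is
    cubic and disappears in the scaling [th ~ N^(- 1 / 2)].  Together
    with the positive curvature, [b <= a] makes [th = 0] the only maximum of the
    modulus on the circle. *)
Lemma saddle_integral_cvg r u a b z : 0 < r < 1 -> 0 < u < 1 -> 0 <= b <= a ->
  0 < saddle_curvature r u a b ->
  z = a * (u / (1 - u)) - b * (r / (1 - r)) ->
  Num.sqrt n.+1%:R * (\int[mu]_(th in `[0, pi])
     (expR (n.+1%:R * saddle_growth r u a b th) * saddle_amplitude u th
      * cos (n.+1%:R * saddle_drift r u a b z th + phase u th)))%R
  @[n --> \oo] -->
  (1 - u)^-1 * (Num.sqrt (2 / saddle_curvature r u a b) * (Num.sqrt pi / 2)).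
Proof.
move=> /andP[r0 r1] /andP[u0 u1] /andP[b0 ba] S0 zE.
have r01 : 0 <= r < 1 by rewrite ltW.
have u01 : 0 <= u < 1 by rewrite ltW.
have a0 := le_trans b0 ba.
have r1' : 0 < 1 - r by rewrite subr_gt0.
have u1' : 0 < 1 - u by rewrite subr_gt0.
rewrite -saddle_amplitude0//.
pose B := 2 * r / (1 - r) ^+ 2; pose A := 2 * u / (1 - u) ^+ 2.
have B0 : 0 <= B by apply: divr_ge0; [rewrite mulr_ge0// ltW|exact: sqr_ge0].
have A0 : 0 <= A by apply: divr_ge0; [rewrite mulr_ge0// ltW|exact: sqr_ge0].
have SE : a * A - b * B = 2 * saddle_curvature r u a b.
  by rewrite /A /B /saddle_curvature; ring.
pose den := (1 + 2 * B) * (1 + 2 * A).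
have den0 : 0 < den by rewrite mulr_gt0// ltr_pwDl// mulr_ge0.
pose Kr := B ^+ 2 + B; pose Ku := A ^+ 2 + A.
have Kr0 : 0 <= Kr by rewrite addr_ge0// sqr_ge0.
have Ku0 : 0 <= Ku by rewrite addr_ge0// sqr_ge0.
pose K1 := b / 2 * Kr + a / 2 * Ku.
pose K2 := a * (1 - u) ^- 3 + b * (1 - r) ^- 3.
have K10 : 0 <= K1 by rewrite addr_ge0// mulr_ge0// divr_ge0.
have K20 : 0 <= K2.
  by rewrite addr_ge0// mulr_ge0// invr_ge0 exprn_ge0// ltW.
apply: (@laplace_method R _ _ _ _ _ (saddle_curvature r u a b / den / 8)
  (K1 + K2) (expR (- (1 / 2) * ln ((1 - u) ^+ 2)))) => //.
- move=> x; apply: cvgB; apply: cvgM; [exact: cvg_cst|exact: continuous_log_growth|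
    exact: cvg_cst|exact: continuous_log_growth].
- move=> x; apply: cvgB; last exact: continuous_mull.
  apply: cvgB; apply: cvgM; [exact: cvg_cst|exact: continuous_phase|
    exact: cvg_cst|exact: continuous_phase].
- exact: continuous_powmod.
- exact: continuous_phase.
- by rewrite !divr_gt0.
- move=> th thp; have th0 : 0 <= th by case/andP: thp.
  rewrite /saddle_growth !log_growthE// -/B -/A.
  have x0 := onem_cos_ge0 th; have xg := onem_cos_ge thp.
  have x2 : 1 - cos th <= 2 by have := cos_geN1 th; lra.
  have bBaA : b * B <= a * A by rewrite -subr_ge0 SE mulr_ge0// ltW.
  have x02 : 0 <= 1 - cos th <= 2 by rewrite x0.
  have := @log_exponent_le R a b A B (1 - cos th) _ B0 A0 bBaA x02.
  rewrite b0 ba => /(_ isT); rewrite SE -/den => h.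
  have k0 : 0 <= saddle_curvature r u a b / den by rewrite divr_ge0// ltW.
  have : saddle_curvature r u a b / den * (th ^+ 2 / 8) <=
      saddle_curvature r u a b / den * (1 - cos th) by rewrite ler_wpM2l.
  rewrite (_ : - (2 * saddle_curvature r u a b / den) * (1 - cos th) =
    - 2 * (saddle_curvature r u a b / den * (1 - cos th))) in h; last by ring.
  rewrite (_ : saddle_curvature r u a b / den / 8 * th ^+ 2 =
    saddle_curvature r u a b / den * (th ^+ 2 / 8)); last by ring.
  by move: (saddle_curvature r u a b / den * (1 - cos th)) h => T h; lra.
- move=> th th0.
  have hr := log_growth_approx r01 th0; have hu := log_growth_approx u01 th0.
  rewrite -/B -/Kr in hr; rewrite -/A -/Ku in hu.
  have -> : saddle_growth r u a b th + saddle_curvature r u a b / 2 * th ^+ 2 =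
    b / 2 * (log_growth r th - r / (1 - r) ^+ 2 * th ^+ 2) -
    a / 2 * (log_growth u th - u / (1 - u) ^+ 2 * th ^+ 2).
    by rewrite /saddle_growth /saddle_curvature; ring.
  apply: le_trans (ler_normB _ _) _; rewrite !normrM.
  rewrite (ger0_norm b0) (ger0_norm a0) normfV (ger0_norm (ler0n R 2)).
  apply: (@le_trans _ _ (K1 * th ^+ 4)); last first.
    by rewrite ler_wpM2r ?exprn_ge0// lerDl.
  by rewrite /K1 mulrDl -!(mulrA (_ / 2)); apply: lerD; rewrite ler_wpM2l// divr_ge0.
- move=> th th0.
  have hr := phase_approx r01 th0; have hu := phase_approx u01 th0.
  have -> : saddle_drift r u a b z th = a * (phase u th - u / (1 - u) * th) -
     b * (phase r th - r / (1 - r) * th).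
    by rewrite /saddle_drift zE; ring.
  apply: le_trans (ler_normB _ _) _; rewrite !normrM (ger0_norm b0) (ger0_norm a0).
  apply: (@le_trans _ _ (K2 * th ^+ 3)); last first.
    by rewrite ler_wpM2r ?exprn_ge0// lerDr.
  by rewrite /K2 mulrDl -(mulrA a) -(mulrA b); apply: lerD; rewrite ler_wpM2l.
- move=> th; rewrite ger0_norm ?expR_ge0// ler_expR.
  rewrite !mulNr lerN2 ler_wpM2l// ler_ln ?posrE ?exprn_gt0// ?normsq_gt0//.
  exact: (normsq_ge th (ltW u0)).
- exact: phase_angle0.
Qed.

(** The integrand of [coefficient_integral] for the exponents
    [s = - N b] and [m = N a + 1], in Laplace form. *)
Lemma coefficient_integrand r u a b z N n s m th :
  s = - (N%:R * b) -> m = N%:R * a + 1 -> n%:R = z * N%:R ->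
  expR (- (s / 2) * ln (normsq r th)) * expR (- (m / 2) * ln (normsq u th)) *
     cos (s * phase r th + m * phase u th - n%:R * th) =
  expR (N%:R * (b / 2 * ln (normsq r 0) - a / 2 * ln (normsq u 0))) *
   (expR (N%:R * saddle_growth r u a b th) * saddle_amplitude u th
      * cos (N%:R * saddle_drift r u a b z th + phase u th)).
Proof.
move=> -> -> ->; rewrite /saddle_amplitude !mulrA -!expRD; congr (expR _ * cos _).
  by rewrite /saddle_growth /log_growth; field.
by rewrite /saddle_drift; ring.
Qed.

End SaddlePoint.

(** * Location of the saddle point *)

Section SaddleAlgebra.
Variable R : realType.
Variables p q z y : R.
Hypotheses (hp : 0 < p < 1) (hq : 0 < q < 1) (hpq : p + q = 1).
Hypotheses (hz : 0 < z < q) (hy : Yplus p q z < y <= 1).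
Let U := Uplus p q y z.
Let w := p * q * (1 - z) / z.

Let p0 : 0 < p. Proof. by case/andP: hp. Qed.
Let q0 : 0 < q. Proof. by case/andP: hq. Qed.
Let z0 : 0 < z. Proof. by case/andP: hz. Qed.
Let zq : z < q. Proof. by case/andP: hz. Qed.
Let y1 : y <= 1. Proof. by case/andP: hy. Qed.
Let q1 : q < 1. Proof. by case/andP: hq. Qed.
Let zn0 : z != 0. Proof. by rewrite gt_eqF. Qed.

Lemma saddle_U0_sqr : U0 p q z ^+ 2 = w.
Proof.
rewrite sqr_sqrtr// divr_ge0 ?ltW// !mulr_gt0// subr_gt0.
exact: lt_trans q1.
Qed.

(** This is where [z < q] enters: [U0^2 > p^2] is equivalent to it. *)
Lemma saddle_U0_gt : p < U0 p q z.
Proof.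
have h : p ^+ 2 < w.
  rewrite /w ltr_pdivlMr// expr2 -!mulrA ltr_pM2l//.
  have -> : p = 1 - q by rewrite -hpq addrK.
  by rewrite -subr_gt0 (_ : _ - _ = q - z) ?subr_gt0//; ring.
rewrite -[ltLHS](ger0_norm (ltW p0)) -sqrtr_sqr ltr_sqrt//.
by apply: le_lt_trans h; exact: sqr_ge0.
Qed.

(** [U] is the larger root of a quadratic with product of roots [U0^2]; the
    condition [Yplus < y] says that the roots are real, positive and distinct. *)
Lemma saddle_U_props :
  [/\ U0 p q z < U,
      z * U ^+ 2 + (p - y + (q - p) * z) * U + p * q * (1 - z) = 0 &
      z < y].
Proof.
have hU0 := saddle_U0_gt; have hw := saddle_U0_sqr.
have V0 : 0 < U0 p q z := lt_trans p0 hU0.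
set V := U0 p q z in hU0 hw V0 *.
have hY : p + (q - p) * z + 2 * z * V < y by case/andP: hy.
pose B := (p - y) / z + q - p.
have hB : 2 * V < - B.
  rewrite -(ltr_pM2l z0) (_ : z * - B = y - p - (q - p) * z); last by rewrite /B; field.
  by lra.
pose disc := B ^+ 2 - 4 * V ^+ 2.
have d0 : 0 < disc.
  rewrite /disc (_ : _ - _ = (- B - 2 * V) * (- B + 2 * V)); last by ring.
  by rewrite mulr_gt0//; lra.
have UE : U = - (1 / 2) * B + 1 / 2 * Num.sqrt disc by [].
have s0 : 0 < Num.sqrt disc by rewrite sqrtr_gt0.
have s2 : Num.sqrt disc ^+ 2 = disc by rewrite sqr_sqrtr// ltW.
split; first by rewrite UE; lra.
- have quad : U ^+ 2 + B * U + w = 0.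
    transitivity (1 / 4 * Num.sqrt disc ^+ 2 - 1 / 4 * disc).
      by rewrite UE -hw /disc; field.
    by rewrite s2 subrr.
  rewrite -(mulr0 z) -quad /B /w; field.
  exact: zn0.
- have hVz : z * p < z * V by rewrite ltr_pM2l.
  have e : p + (q - p) * z + 2 * (z * p) = p + z.
    have -> : q = 1 - p by rewrite -hpq addrC addKr.
    by ring.
  have e2 : 2 * z * V = 2 * (z * V) by ring.
  rewrite e2 in hY; move: ((q - p) * z) (z * p) (z * V) e hVz hY => c1 c2 c3.
  by have := p0; lra.
Qed.

(* The generating function in w has its saddle point at w = 1 / U; r is its
   image under v = w / (1 + q w). *)
Let r := (U + q)^-1.
Let u := q * r.

Let Vp : p < U0 p q z. Proof. exact: saddle_U0_gt. Qed.
Let Up : 0 < U - p.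
Proof. by rewrite subr_gt0 (lt_trans Vp)//; have [] := saddle_U_props. Qed.
Let Ugt0 : 0 < U. Proof. by rewrite (lt_trans p0)// -subr_gt0. Qed.
Let Uq : 0 < U + q. Proof. exact: addr_gt0. Qed.
Let Un0 : U != 0. Proof. by rewrite gt_eqF. Qed.
Let Upn0 : U - p != 0. Proof. by rewrite gt_eqF. Qed.
Let Uqn0 : U + q != 0. Proof. by rewrite gt_eqF. Qed.

Lemma saddle_r : 0 < r < 1.
Proof.
rewrite invr_gt0 Uq/= invf_lt1// -[ltLHS]hpq ltrD2r.
by rewrite -subr_gt0.
Qed.

Lemma saddle_onem_r : 1 - r = (U - p) / (U + q).
Proof. by rewrite /r (_ : p = 1 - q); [field|rewrite -hpq addrK]. Qed.

Lemma saddle_onem_u : 1 - u = U / (U + q).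
Proof. by rewrite /u /r; field. Qed.

Lemma saddle_u : 0 < u < 1.
Proof.
rewrite mulr_gt0 ?invr_gt0//=.
by rewrite -subr_gt0 saddle_onem_u divr_gt0.
Qed.

(** The stationarity condition; cleared of denominators it is the quadratic
    equation of [U]. *)
Lemma saddle_equation : z = (1 - z) * (u / (1 - u)) - (1 - y) * (r / (1 - r)).
Proof.
rewrite saddle_onem_r saddle_onem_u.
have [_ quad _] := saddle_U_props.
have -> : (1 - z) * (u / (U / (U + q))) - (1 - y) * (r / ((U - p) / (U + q))) =
   ((1 - z) * q * (U - p) - (1 - y) * U) / (U * (U - p)).
  by rewrite /u /r; field; rewrite Un0 Upn0 Uqn0.
apply: (canRL (mulfK _)); first by rewrite mulf_neq0.
apply/eqP; rewrite -subr_eq0 -quad; apply/eqP.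
have -> : q = 1 - p by rewrite -hpq addrC addKr.
by ring.
Qed.

Lemma saddle_curvatureE : saddle_curvature r u (1 - z) (1 - y) =
  z * (U ^+ 2 - w) * (U + q) / (U ^+ 2 * (U - p)).
Proof.
have [_ quad _] := saddle_U_props.
have e : (1 - y) * U = (U - p) * ((1 - z) * q - z * U).
  apply/eqP; rewrite -subr_eq0 -quad; apply/eqP.
  have -> : q = 1 - p by rewrite -hpq addrC addKr.
  by ring.
have yE : 1 - y = (U - p) * ((1 - z) * q - z * U) / U by rewrite -e mulfK.
rewrite /saddle_curvature saddle_onem_r saddle_onem_u yE /u /r /w.
by field; rewrite zn0 Un0 Upn0 Uqn0.
Qed.

Let Uw : 0 < U ^+ 2 - w.
Proof.
have [VU _ _] := saddle_U_props.
rewrite -saddle_U0_sqr subr_sqr mulr_gt0 ?subr_gt0// addr_gt0//.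
exact: lt_trans p0 Vp.
Qed.

Lemma saddle_curvature_gt0 : 0 < saddle_curvature r u (1 - z) (1 - y).
Proof. by rewrite saddle_curvatureE divr_gt0 ?mulr_gt0// exprn_gt0. Qed.

Lemma Lplus_saddle :
  Lplus p q y z = (1 - u)^-1 / Num.sqrt (saddle_curvature r u (1 - z) (1 - y)).
Proof.
have S0 := saddle_curvature_gt0.
have u1 : 0 < 1 - u by rewrite subr_gt0; case/andP: saddle_u.
rewrite /Lplus -/U saddle_U0_sqr.
have -> : (U - p) * (U + q) / (z * (U ^+ 2 - w)) =
   (1 - u) ^- 2 / saddle_curvature r u (1 - z) (1 - y).
  rewrite saddle_curvatureE saddle_onem_u.
  by field; rewrite zn0 Un0 Upn0 Uqn0 gt_eqF.
rewrite sqrtrM ?invr_ge0 ?sqr_ge0// !sqrtrV ?sqr_ge0 ?(ltW S0)//.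
by rewrite sqrtr_sqr gtr0_norm.
Qed.

Lemma psiplus_saddle : psiplus p q y z =
  (1 - y) * ln (1 - r) - (1 - z) * ln (1 - u) - z * ln r.
Proof.
rewrite /psiplus -/U saddle_onem_r saddle_onem_u /r.
rewrite !lnM ?posrE ?mulr_gt0 ?powR_gt0// ?invr_gt0//.
rewrite !lnV ?posrE// !ln_powR.
by ring.
Qed.

End SaddleAlgebra.

(** * The asymptotic formula *)

(** [krawtchouk_rising] and [coefficient_integral] at the radius [r] of the
    saddle point; the value of the integrand at [th = 0], together with [r^n],
    gives the exponential. *)
Lemma krawtchouk_integral (R : realType) (p q z y : R) (n N : nat)
    (r := (Uplus p q y z + q)^-1) (u := q * r) :
  0 < p < 1 -> 0 < q < 1 -> p + q = 1 -> 0 < z < q -> Yplus p q z < y <= 1 ->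
  n%:R = z * N%:R ->
  pi * krawtchouk p q N n (y * N%:R) =
  expR (N%:R * psiplus p q y z) *
  (\int[@lebesgue_measure R]_(th in `[0, pi])
     (expR (N%:R * saddle_growth r u (1 - z) (1 - y) th) * saddle_amplitude u th
      * cos (N%:R * saddle_drift r u (1 - z) (1 - y) z th + phase u th)))%R.
Proof.
move=> hp hq hpq hz hy nE.
have /andP[r0 r1] : 0 < r < 1 := saddle_r hp hq hpq hz hy.
have /andP[u0 u1] : 0 < u < 1 := saddle_u hp hq hpq hz hy.
have r01 : 0 <= r < 1 by rewrite ltW.
have u01 : 0 <= u < 1 by rewrite ltW.
have nN : (n <= N)%N.
  rewrite -(@ler_nat R) nE ler_piMl// ltW//.
  by case/andP: hz => _ /lt_trans; apply; case/andP: hq.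
pose s := - (N%:R * (1 - y)); pose m := N%:R * (1 - z) + 1.
have sE : - (N%:R - y * N%:R) = s by rewrite /s; ring.
have mE : (N - n).+1%:R = m.
  by rewrite -natr1 natrB// nE /m; ring.
have pE : p = 1 - q by rewrite -hpq addrK.
have kE : pi * krawtchouk p q N n (y * N%:R) * r ^+ n =
  pi * \sum_(j < n.+1) (rising s j * r ^+ j) * (rising m (n - j) * u ^+ (n - j)).
  have -> : y * N%:R = N%:R - (N%:R - y * N%:R) by ring.
  rewrite pE krawtchouk_rising// sE mE -mulrA; congr (_ * _).
  rewrite mulr_suml; apply: eq_bigr => -[j /= jn] _.
  have -> : r ^+ n = r ^+ j * r ^+ (n - j) by rewrite -exprD subnKC.
  by rewrite /u exprMn; ring.
apply: (mulIf (_ : r ^+ n != 0)); first by rewrite expf_neq0// gt_eqF.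
rewrite kE -(coefficient_integral s m n r01 u01).
under eq_Rintegral => th _ do
  rewrite (coefficient_integrand r u th (erefl s) (erefl m) nE).
rewrite RintegralZl//; last first.
  apply: continuous_integrable => x; apply: cvgM; first apply: cvgM.
  - apply: (@continuous_comp _ _ _
      (fun th => N%:R * saddle_growth r u (1 - z) (1 - y) th) (@expR R));
      last exact: continuous_expR.
    apply: cvgM; first exact: cvg_cst.
    by apply: cvgB; apply: cvgM; [exact: cvg_cst|exact: continuous_log_growth|
      exact: cvg_cst|exact: continuous_log_growth].
  - exact: continuous_powmod.
  - apply: (@continuous_comp _ _ _
      (fun th => N%:R * saddle_drift r u (1 - z) (1 - y) z th + phase u th) (@cos R));
      last exact: continuous_cos.
    apply: cvgD; last exact: continuous_phase.
    apply: cvgM; first exact: cvg_cst.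
    apply: cvgB; last exact: continuous_mull.
    by apply: cvgB; apply: cvgM; [exact: cvg_cst|exact: continuous_phase|
      exact: cvg_cst|exact: continuous_phase].
rewrite [RHS]mulrAC; congr (_ * _).
have -> : r ^+ n = expR (N%:R * (z * ln r)).
  by rewrite mulrA [N%:R * z]mulrC -nE expRM_natl lnK.
rewrite -expRD; congr expR.
rewrite !ln_normsq0// (psiplus_saddle hp hq hpq hz hy) -/r -/u.
by field.
Qed.

Theorem mainTheorem4 (R : realType) (p q : R)
    (hp : 0 < p < 1) (hq : 0 < q < 1) (hpq : p + q = 1)
    (z y : R) (hz : 0 < z < q) (hy : Yplus p q z < y <= 1) :
  krawtchouk p q N (Num.truncn (z * N%:R)) (y * N%:R)
    / krawtchouk_approx p q y z N
  @[N --> within [set N : nat | z * N%:R \is a Num.int] \oo] --> (1 : R).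
Proof.
pose r := (Uplus p q y z + q)^-1; pose u := q * r.
have r01 : 0 < r < 1 := saddle_r hp hq hpq hz hy.
have u01 : 0 < u < 1 := saddle_u hp hq hpq hz hy.
pose S := saddle_curvature r u (1 - z) (1 - y).
have S0 : 0 < S := saddle_curvature_gt0 hp hq hpq hz hy.
have ab : 0 <= 1 - y <= 1 - z.
  have [_ _ zy] := saddle_U_props hp hq hpq hz hy.
  by case/andP: hy => _ y1; rewrite subr_ge0 y1 lerD2l lerN2 ltW.
have zE : z = (1 - z) * (u / (1 - u)) - (1 - y) * (r / (1 - r)) :=
  saddle_equation hp hq hpq hz hy.
pose I N := (\int[@lebesgue_measure R]_(th in `[0, pi])
     (expR (N%:R * saddle_growth r u (1 - z) (1 - y) th) * saddle_amplitude u th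
      * cos (N%:R * saddle_drift r u (1 - z) (1 - y) z th + phase u th)))%R.
have p0 : 0 < pi :> R := pi_gt0 R.
have u1 : 0 < 1 - u by rewrite subr_gt0; case/andP: u01.
have L0 : 0 < Lplus p q y z.
  by rewrite (Lplus_saddle hp hq hpq hz hy) divr_gt0 ?invr_gt0 ?sqrtr_gt0.
pose C : R := Num.sqrt (2 * pi) / (pi * Lplus p q y z).
have lim : C * (Num.sqrt N%:R * I N) @[N --> \oo] --> (1 : R).
  have C1 : C * ((1 - u)^-1 * (Num.sqrt (2 / S) * (Num.sqrt pi / 2))) = 1.
    rewrite /C (Lplus_saddle hp hq hpq hz hy) -/r -/u -/S.
    rewrite !sqrtrM// sqrtrV ?ltW//.
    have t2 : Num.sqrt 2 * Num.sqrt 2 = 2 :> R by rewrite -expr2 sqr_sqrtr.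
    have tp : Num.sqrt pi * Num.sqrt pi = pi :> R by rewrite -expr2 sqr_sqrtr// ltW.
    have s0 : Num.sqrt S != 0 by rewrite gt_eqF// sqrtr_gt0.
    move: (pi : R) p0 tp => c c0 tp.
    transitivity ((Num.sqrt 2 * Num.sqrt 2) * (Num.sqrt c * Num.sqrt c) / (2 * c)).
      by field; rewrite s0 !gt_eqF.
    by rewrite t2 tp divff// mulf_neq0// gt_eqF.
  have lim := saddle_integral_cvg r01 u01 ab S0 zE.
  rewrite -cvg_shiftS/=.
  have Clim := cvgMl_tmp (a := C) lim; rewrite C1 in Clim.
  exact: Clim.
have limW : C * (Num.sqrt N%:R * I N)
    @[N --> within [set N : nat | z * N%:R \is a Num.int] \oo] --> (1 : R).
  by apply: cvg_trans lim; apply: cvg_app; exact: cvg_within.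
apply: cvg_trans limW; apply: near_eq_cvg.
rewrite near_withinE; near=> N => zN.
have N0 : 0 < N%:R :> R by rewrite ltr0n; near: N; exact: nbhs_infty_gt.
have nE : (Num.truncn (z * N%:R))%:R = z * N%:R.
  have z0 : 0 < z by case/andP: hz.
  by apply: truncnK; rewrite natrEint zN mulr_ge0// ltW.
have := krawtchouk_integral hp hq hpq hz hy nE; rewrite -/r -/u -/(I N) => kE.
have {kE} -> : krawtchouk p q N (Num.truncn (z * N%:R)) (y * N%:R) =
    expR (N%:R * psiplus p q y z) * I N / pi.
  by rewrite -kE mulrAC divff ?mul1r// gt_eqF.
have tp : 0 <= 2 * pi :> R by rewrite mulr_ge0// ltW.
rewrite /krawtchouk_approx /C (sqrtrM N%:R tp).
have e0 : expR (N%:R * psiplus p q y z) != 0 by rewrite gt_eqF// expR_gt0.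
have sp : Num.sqrt (2 * pi) != 0 :> R by rewrite gt_eqF// sqrtr_gt0 mulr_gt0.
have sN : Num.sqrt N%:R != 0 :> R by rewrite gt_eqF// sqrtr_gt0.
move: (Num.sqrt (2 * pi)) (Num.sqrt N%:R) (expR _) (I N) sp sN e0 => A B E J A0 B0 E0.
move: (pi : R) (Lplus p q y z) (lt0r_neq0 p0) (lt0r_neq0 L0) => c L c0 Ln0.
by field; rewrite A0 B0 E0 c0 Ln0.
Unshelve. all: by end_near. Qed.
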